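(* Let $n\in\mathbb{N}$. The maximal subgroups of $M_n(\mathbb{T})$ are, up to isomorphism, exactly the groups of the form $$\prod_{\alpha=1}^z\bigl((\mathbb{R}\times G_\alpha)\wr\mathcal{S}_{h_\alpha}\bigr)$$ with $z\in\mathbb{N}$, $h_\alpha\in\mathbb{N}$ and $G_\alpha$ finite groups, where for each $1\le\alpha\le z$ there exists $n_\alpha\in\mathbb{N}$ such that (i) $\sum_{\alpha=1}^z n_\alpha h_\alpha\le n$; (ii) each $G_\alpha$ is 2-closed on $n_\alpha$ points; (iii) at most one $\alpha$ has $n_\alpha=1$; and (iv) if $G_{\alpha_1},G_{\alpha_2},G_{\alpha_3}$ are trivial for distinct $\alpha_1,\alpha_2,\alpha_3$, then $n_{\alpha_i}>2$ for some $i$.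
   Context: $\mathbb{N}$ is the set of positive integers. $\mathbb{T} = \mathbb{R}\cup\{-\infty\}$ is the tropical semiring, with $\oplus = \max$ and $\otimes = +$. $M_n(\mathbb{T})$ is the monoid of $n\times n$ matrices over $\mathbb{T}$ under tropical matrix multiplication. A maximal subgroup of a semigroup is a subsemigroup that is a group (its identity being any idempotent of the semigroup) and is maximal among such under inclusion; equivalently, an $\mathcal{H}$-class containing an idempotent, where two elements of a monoid are $\mathcal{H}$-related if they generate the same principal left ideal and the same principal right ideal. $\mathbb{R}$ denotes the additive group of real numbers, $\mathcal{S}_h$ is the symmetric group on $\{1,\dots,h\}$, and $K\wr\mathcal{S}_h=K^h\rtimes\mathcal{S}_h$ with $\mathcal{S}_h$ permuting the coordinates. A permutation group $G\le\mathcal{S}_k$ is 2-closed if $G$ contains every element of $\mathcal{S}_k$ which preserves each $G$-orbit of ordered pairs of points; a group is 2-closed on $k$ points if it is isomorphic to a 2-closed subgroup of $\mathcal{S}_k$.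
   Formalization: The maximal subgroup consisting only of the zero matrix (all entries −∞) is excluded in the direction ''every maximal subgroup has this form'': it is trivial, whereas every product with z, h_α ≥ 1 contains a copy of ℝ, so the claim as stated fails for it. *)

(* Defs.v *)
From HB Require Import structures.
From mathcomp Require Import all_boot all_order all_algebra all_fingroup.
From mathcomp Require Import classical_sets reals.

Set Implicit Arguments.
Unset Strict Implicit.
Unset Printing Implicit Defensive.

Import Order.TTheory GRing.Theory Num.Theory.

(* [None] is -oo, the zero of the semiring; its one is the real number 0.     *)
Definition trop (R : realType) : Type := option R.

HB.instance Definition _ (R : realType) := Choice.on (trop R).

Section TropicalSemiring.
Local Open Scope ring_scope.
Variable R : realType.
Implicit Types x y z : trop R.

Definition trop_add x y : trop R :=
  match x, y with
  | None, _ => y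
  | _, None => x
  | Some a, Some b => Some (Num.max a b)
  end.

Definition trop_mul x y : trop R :=
  match x, y with
  | Some a, Some b => Some (a + b)
  | _, _ => None
  end.

Fact trop_addA : associative trop_add.
Proof. by move=> [x|] [y|] [z|] //=; rewrite maxA. Qed.

Fact trop_addC : commutative trop_add.
Proof. by move=> [x|] [y|] //=; rewrite maxC. Qed.

Fact trop_add0 : left_id None trop_add.
Proof. by case. Qed.

Fact trop_mulA : associative trop_mul.
Proof. by move=> [x|] [y|] [z|] //=; rewrite addrA. Qed.

Fact trop_mulC : commutative trop_mul.
Proof. by move=> [x|] [y|] //=; rewrite addrC. Qed.

Fact trop_mul1 : left_id (Some 0) trop_mul.
Proof. by move=> [x|] //=; rewrite add0r. Qed.

Fact trop_mulDl : left_distributive trop_mul trop_add.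
Proof. by move=> [x|] [y|] [z|] //=; rewrite addr_maxl. Qed.

Fact trop_mul0 : left_zero None trop_mul.
Proof. by []. Qed.

Fact trop_oner_neq0 : Some 0 != None :> trop R.
Proof. by []. Qed.

HB.instance Definition _ := GRing.isNmodule.Build (trop R)
  trop_addA trop_addC trop_add0.
HB.instance Definition _ := GRing.Nmodule_isComNzSemiRing.Build (trop R)
  trop_mulA trop_mulC trop_mul1 trop_mulDl trop_mul0 trop_oner_neq0.

End TropicalSemiring.

Section MaximalSubgroups.
Local Open Scope classical_set_scope.
Variables (T : Type) (op : T -> T -> T).

(* The identity [e] is any idempotent of T; T itself need not have a unit.    *)
Definition is_subgroup (H : set T) : Prop :=
  (forall x y, H x -> H y -> H (op x y)) /\
  exists2 e, H e &
    (forall x, H x -> op e x = x /\ op x e = x) /\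
    (forall x, H x -> exists2 y, H y & op x y = e /\ op y x = e).

Definition is_maximal_subgroup (H : set T) : Prop :=
  is_subgroup H /\ forall K : set T, is_subgroup K -> H `<=` K -> K = H.

Definition isomorphic_to (H : set T) (K : groupType) : Prop :=
  exists f : K -> T,
    [/\ injective f, forall x y, f (x * y)%g = op (f x) (f y) & range f = H].

End MaximalSubgroups.

Section WreathProduct.
Local Open Scope group_scope.
Variables (K : groupType) (h : nat).

Definition wreath : Type := ({ffun 'I_h -> K} * 'S_h)%type.

HB.instance Definition _ := Choice.on wreath.

(* Permutations compose from left to right, (s * t) i = t (s i), so that      *)
(* s . g := g \o s is a left action of 'S_h on K^h.                           *)
Definition wreath_mul (u v : wreath) : wreath :=
  ([ffun i => u.1 i * v.1 (u.2 i)], u.2 * v.2).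

Definition wreath_one : wreath := ([ffun=> 1], 1).

Definition wreath_inv (u : wreath) : wreath :=
  ([ffun i => (u.1 (u.2^-1 i))^-1], u.2^-1).

Fact wreath_mulA : associative wreath_mul.
Proof.
move=> u v w; rewrite /wreath_mul /= mulgA; congr (_, _).
by apply/ffunP=> i; rewrite !ffunE /= permM mulgA.
Qed.

Fact wreath_mul1 : left_id wreath_one wreath_mul.
Proof.
move=> [f s]; rewrite /wreath_mul /= mul1g; congr (_, _).
by apply/ffunP=> i; rewrite !ffunE perm1 mul1g.
Qed.

Fact wreath_mulr1 : right_id wreath_one wreath_mul.
Proof.
move=> [f s]; rewrite /wreath_mul /= mulg1; congr (_, _).
by apply/ffunP=> i; rewrite !ffunE mulg1.
Qed.

Fact wreath_mulV : left_inverse wreath_one wreath_inv wreath_mul.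
Proof.
move=> [f s]; rewrite /wreath_mul /wreath_one /= mulVg; congr (_, _).
by apply/ffunP=> i; rewrite !ffunE mulVg.
Qed.

Fact wreath_mulrV : right_inverse wreath_one wreath_inv wreath_mul.
Proof.
move=> [f s]; rewrite /wreath_mul /wreath_one /= mulgV; congr (_, _).
by apply/ffunP=> i; rewrite !ffunE permK mulgV.
Qed.

HB.instance Definition _ := isGroup.Build wreath
  wreath_mulA wreath_mul1 wreath_mulr1 wreath_mulV wreath_mulrV.

End WreathProduct.

Section DirectProduct.
Local Open Scope group_scope.
Variables (I : finType) (K : I -> groupType).

Definition gprod : Type := {dffun forall i : I, K i}.

HB.instance Definition _ := Choice.on gprod.

Definition gprod_mul (u v : gprod) : gprod := [ffun i => u i * v i].
Definition gprod_one : gprod := [ffun i => 1].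
Definition gprod_inv (u : gprod) : gprod := [ffun i => (u i)^-1].

Fact gprod_mulA : associative gprod_mul.
Proof. by move=> u v w; apply/ffunP=> i; rewrite !ffunE mulgA. Qed.

Fact gprod_mul1 : left_id gprod_one gprod_mul.
Proof. by move=> u; apply/ffunP=> i; rewrite !ffunE mul1g. Qed.

Fact gprod_mulr1 : right_id gprod_one gprod_mul.
Proof. by move=> u; apply/ffunP=> i; rewrite !ffunE mulg1. Qed.

Fact gprod_mulV : left_inverse gprod_one gprod_inv gprod_mul.
Proof. by move=> u; apply/ffunP=> i; rewrite !ffunE mulVg. Qed.

Fact gprod_mulrV : right_inverse gprod_one gprod_inv gprod_mul.
Proof. by move=> u; apply/ffunP=> i; rewrite !ffunE mulgV. Qed.

HB.instance Definition _ := isGroup.Build gprod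
  gprod_mulA gprod_mul1 gprod_mulr1 gprod_mulV gprod_mulrV.

End DirectProduct.

Section TwoClosed.
Local Open Scope group_scope.
Variable k : nat.

Definition pair_act (s : 'S_k) (p : 'I_k * 'I_k) : 'I_k * 'I_k :=
  (s p.1, s p.2).

Definition pair_orbit (G : {set 'S_k}) (p : 'I_k * 'I_k)
    : {set 'I_k * 'I_k} :=
  [set pair_act g p | g in G].

Definition two_closed (G : {group 'S_k}) : Prop :=
  forall s : 'S_k,
    (forall p, pair_act s @: pair_orbit G p = pair_orbit G p) -> s \in G.

End TwoClosed.

Definition two_closed_on (gT : finGroupType) (k : nat) : Prop :=
  exists2 H : {group 'S_k}, two_closed H & [set: gT] \isog H.

(* Algebra.to_multiplicative R is (R, +), as a multiplicative group.          *)
Definition product_of_wreaths (R : realType) (z : nat) (h : 'I_z -> nat)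
    (G : 'I_z -> finGroupType) : groupType :=
  gprod (fun a : 'I_z => wreath (Algebra.to_multiplicative R * G a)%type (h a)).

Definition admissible (n z : nat) (h : 'I_z -> nat)
    (G : 'I_z -> finGroupType) : Prop :=
  [/\ 0 < z, forall a, 0 < h a &
    exists m : 'I_z -> nat, (forall a, 0 < m a) /\
      [/\ \sum_(a < z) m a * h a <= n,
          forall a, two_closed_on (G a) (m a),
          forall a b, m a = 1 -> m b = 1 -> a = b &
          forall a b c, a != b -> a != c -> b != c ->
            [set: G a]%g = 1%g -> [set: G b]%g = 1%g -> [set: G c]%g = 1%g ->
            [\/ 2 < m a, 2 < m b | 2 < m c]]].

(* Main.v *)
Require Import Defs.
From HB Require Import structures.
From mathcomp Require Import all_boot all_order all_algebra all_fingroup.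
From mathcomp Require Import classical_sets reals.
From mathcomp Require Import boolp zify ring lra.

Set Implicit Arguments.
Unset Strict Implicit.
Unset Printing Implicit Defensive.

Import Order.TTheory GRing.Theory Num.Theory.

(** A subgroup of M_n(T) containing an idempotent E has identity E, so the
    maximal subgroups are the groups of units of the local monoids E M_n(T) E
    ([maximal_subgroupE], [local_units_maximal]).

    A nonzero idempotent factors as E = A B through an idempotent F = B A of
    size r, 0 < r <= n, with zero diagonal and no two proportional columns,
    and X |-> B X A identifies the two unit groups ([reduce_idempotent],
    [transport_local_units]). For such an F every local unit is F multiplied
    by a monomial matrix commuting with it ([local_units_reduced]). So the
    group is the automorphism group of a weighted digraph on r points:
    permutations [s] with a gauge [d] such that d_i + F(s i, s j) = F(i, j) +
    d_j.

    Averaging F over the finitely many permutations that occur makes all of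
    them preserve F exactly; the gauge of an automorphism is then constant on
    each connected component ([average_idempotent]). Let the components fall
    into isomorphism classes, the class [a] having h_a members of size n_a. An
    automorphism permutes the components of each class, and on each component
    it consists of an element of R, the constant gauge, and an element of the
    stabiliser G_a of one component, which gives the product of wreath
    products ([automorphisms_block_sum], [automorphisms_components]). The
    group G_a is 2-closed, being the stabiliser of a function on pairs of
    points. All one-point components are isomorphic, and a two-point component
    with trivial G_a must have exactly one finite off-diagonal entry, which a
    gauge turns into any other value; hence the restrictions on the n_a and
    G_a with n_a <= 2 ([components_admissible]).

    Conversely a 2-closed group H is the full automorphism group of a kernel
    that gives distinct real weights to the off-diagonal pair orbits of H,
    except that entries from a higher to a lower point orbit are -oo
    ([orbit_kernel]). The -oo entries force an automorphism to fix every point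
    orbit, after which row sums over the top orbit force its gauge to be
    constant ([orbit_kernel_gauge]), so that it preserves the weights and lies
    in H. Scaling the weights by very different factors keeps different blocks
    from being isomorphic, unless the weights can be gauged away, which
    happens only for the trivial group on one or two points; the restrictions
    on small n_a allow for just these exceptions ([distinguishing_sizes],
    [admissible_realised]). *)

(** * Maximal subgroups of a semigroup *)

Section LocalUnits.
Local Open Scope classical_set_scope.
Variables (T : Type) (op : T -> T -> T).
Hypothesis opA : associative op.

Definition local_units (e : T) : set T :=
  [set x | [/\ op e x = x, op x e = x &
     exists y, [/\ op e y = y, op y e = y, op x y = e & op y x = e]]].

(** A subgroup containing [e] has [e] as its only idempotent, hence as its
    identity, so all its elements are local units at [e]. *)
Lemma local_units_maximal e : op e e = e ->
  is_maximal_subgroup op (local_units e).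
Proof.
move=> ee; split.
  split.
    move=> x x' [ex xe [y [ey ye xy yx]]] [ex' xe' [y' [ey' ye' xy' yx']]].
    split; [by rewrite opA ex|by rewrite -opA xe'|].
    exists (op y' y); split; [by rewrite opA ey'|by rewrite -opA ye| |].
      by rewrite opA -(opA x) xy' xe xy.
    by rewrite opA -(opA y') yx ye' yx'.
  exists e; first by split=> //; exists e.
  split; first by move=> x [].
  move=> x [ex xe [y [ey ye xy yx]]]; exists y => //.
  by split=> //; exists x.
move=> K [Kop [e' Ke' [Ke'1 Kinv]]] sub.
have Ke : K e by apply: sub; split=> //; exists e.
have e_e' : e = e'.
  have [y Ky [ey ye]] := Kinv _ Ke.
  by have [<- _] := Ke'1 _ Ke; rewrite -ye -opA ee.
rewrite -e_e' in Ke'1 Kinv; apply/seteqP; split=> // x Kx.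
have [y Ky [xy yx]] := Kinv _ Kx; have [ex xe] := Ke'1 _ Kx.
by split=> //; exists y; have [ey ye] := Ke'1 _ Ky.
Qed.

Lemma maximal_subgroupE H : is_maximal_subgroup op H ->
  exists2 e, op e e = e & H = local_units e.
Proof.
move=> [[Hop [e He [He1 Hinv]]] Hmax].
have ee : op e e = e by have [] := He1 _ He.
exists e => //; symmetry; apply: Hmax; first by have [] :=
  local_units_maximal ee.
move=> x Hx; have [y Hy [xy yx]] := Hinv _ Hx; have [ex xe] := He1 _ Hx.
by split=> //; exists y; have [ey ye] := He1 _ Hy.
Qed.

End LocalUnits.

Lemma isomorphic_trans (T T' : Type) (op : T -> T -> T) (op' : T' -> T' -> T')
    (H : set T) (H' : set T') (K : groupType) (g : T -> T') :
  {in H &, injective g} ->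
  (forall x y, H x -> H y -> g (op x y) = op' (g x) (g y)) ->
  (g @` H = H')%classic ->
  isomorphic_to op H K -> isomorphic_to op' H' K.
Proof.
move=> ginj gM gH [f [finj fM frange]].
have Hf x : H (f x) by rewrite -frange; exists x.
exists (g \o f); split.
- by move=> x y /= /ginj; rewrite !inE => /(_ (Hf x) (Hf y))/finj.
- by move=> x y /=; rewrite fM gM.
rewrite -gH -frange; apply/seteqP; split=> [_ [x _ <-]|_ [_ [x _ <-] <-]] /=.
  by exists (f x) => //; exists x.
by exists x.
Qed.

Section Transport.
Local Open Scope ring_scope.
Variables (S : pzSemiRingType) (n r : nat).

(** The maps Y |-> A Y B and X |-> B X A are mutually inverse. *)
Lemma transport_local_units (E : 'M[S]_n) (F : 'M[S]_r) (A : 'M[S]_(n, r))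
    (B : 'M[S]_(r, n)) (K : groupType) :
  E *m E = E -> F *m F = F -> A *m B = E -> B *m A = F ->
  isomorphic_to mulmx (local_units mulmx F) K ->
  isomorphic_to mulmx (local_units mulmx E) K.
Proof.
move=> EE FF AB BA; apply: (@isomorphic_trans _ _ _ _ _ _ _ (fun Y =>
  A *m Y *m B)).
- move=> Y Y' /set_mem[FY YF _] /set_mem[FY' YF' _].
  move=> YY'; have : B *m (A *m Y *m B) *m A = B *m (A *m Y' *m B) *m A by
    rewrite YY'.
  by rewrite !mulmxA BA FY FY' -!mulmxA BA YF YF'.
- move=> X Y [FX XF _] _.
  by rewrite !mulmxA -(mulmxA (A *m X) B A) BA -(mulmxA A X F) XF.
apply/seteqP; split=> [_ [X [FX XF [Y [FY YF XY YX]]] <-]|X [EX XE [Y [EY YE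
  XY YX]]]].
  have key (Z : 'M_r) : F *m Z = Z -> Z *m F = Z ->
      E *m (A *m Z *m B) = A *m Z *m B /\ A *m Z *m B *m E = A *m Z *m B.
    move=> FZ ZF; rewrite -AB !mulmxA; split.
      by rewrite -(mulmxA A B A) BA -(mulmxA A F Z) FZ.
    by rewrite -(mulmxA (A *m Z) B A) BA -(mulmxA A Z F) ZF.
  have [? ?] := key _ FX XF; have [? ?] := key _ FY YF.
  have keyM (Z Z' : 'M_r) : Z *m F = Z -> Z *m Z' = F ->
      A *m Z *m B *m (A *m Z' *m B) = E.
    move=> ZF ZZ; rewrite !mulmxA -(mulmxA (A *m Z) B A) BA -(mulmxA A Z F) ZF.
    by rewrite -(mulmxA A Z Z') ZZ -BA !mulmxA AB -mulmxA AB EE.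
  by split=> //; exists (A *m Y *m B); split=> //; apply: keyM.
exists (B *m X *m A); last by rewrite !mulmxA AB -!mulmxA AB !mulmxA EX XE.
have key (Z : 'M_n) : E *m Z = Z -> Z *m E = Z ->
    F *m (B *m Z *m A) = B *m Z *m A /\ B *m Z *m A *m F = B *m Z *m A.
  move=> FZ ZF; rewrite -BA !mulmxA; split.
    by rewrite -(mulmxA B A B) AB -(mulmxA B E Z) FZ.
  by rewrite -(mulmxA (B *m Z) A B) AB -(mulmxA B Z E) ZF.
have [? ?] := key _ EX XE; have [? ?] := key _ EY YE.
have keyM (Z Z' : 'M_n) : Z *m E = Z -> Z *m Z' = E ->
    B *m Z *m A *m (B *m Z' *m A) = F.
  move=> ZE ZZ; rewrite !mulmxA -(mulmxA (B *m Z) A B) AB -(mulmxA B Z E) ZE.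
  by rewrite -(mulmxA B Z Z') ZZ -AB !mulmxA BA -mulmxA BA FF.
by split=> //; exists (B *m Y *m A); split=> //; apply: keyM.
Qed.

End Transport.

(** * Order and scalars in the tropical semiring *)

Section TropOrder.
Local Open Scope ring_scope.
Variable R : realType.
Implicit Types x y z : trop R.

(** The natural order of an idempotent semiring: x <= y when x + y = y. *)
Definition le_trop x y : bool :=
  match x, y with
  | None, _ => true
  | Some _, None => false
  | Some a, Some b => a <= b
  end.

(** The embedding of R as the group of units of the semiring. *)
Definition expT (a : R) : trop R := Some a.

Lemma expTD a b : expT (a + b) = expT a * expT b.
Proof. by []. Qed.

Lemma expTM (a b : Algebra.to_multiplicative R) :
  expT (a * b)%g = expT a * expT b.
Proof. by []. Qed.

Lemma expTV (a : Algebra.to_multiplicative R) : expT a * expT a^-1%g = 1.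
Proof. by congr Some; rewrite /= subrr. Qed.

Lemma expT_inj : injective expT.
Proof. by move=> a b []. Qed.

Lemma expTK a x : expT (- a) * (expT a * x) = x.
Proof. by case: x => [b|] //; congr Some => /=; rewrite addKr. Qed.

Lemma expT_mulI a : injective ( *%R (expT a)).
Proof. exact: can_inj (expTK a). Qed.

Lemma le_trop_refl x : le_trop x x.
Proof. by case: x => //= a. Qed.

Lemma le_trop_trans y x z : le_trop x y -> le_trop y z -> le_trop x z.
Proof. by case: x y z => [a|] [b|] [c|] //=; apply: le_trans. Qed.

Lemma le_trop_anti x y : le_trop x y -> le_trop y x -> x = y.
Proof.
by case: x y => [a|] [b|] //= ab ba; congr Some; apply/le_anti; rewrite ab.
Qed.

Lemma le_trop_mul x y z t : le_trop x y -> le_trop z t ->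
  le_trop (x * z) (y * t).
Proof. by case: x y z t => [a|] [b|] [c|] [d|] //=; apply: lerD. Qed.

Lemma le_trop_expM a x y : le_trop (expT a * x) (expT a * y) = le_trop x y.
Proof. by case: x y => [b|] [c|] //=; rewrite lerD2l. Qed.

Lemma le_trop_sum (I : finType) (f : I -> trop R) i :
  le_trop (f i) (\sum_j f j).
Proof.
rewrite (bigD1 i) //=; case: (f i) (\sum_(_ | _) _) => [a|] [b|] //=.
by rewrite le_max lexx.
Qed.

Lemma sum_trop_le (I : finType) (f : I -> trop R) x :
  (forall i, le_trop (f i) x) -> le_trop (\sum_j f j) x.
Proof.
move=> fx; apply: (big_ind (fun y => le_trop y x)) => // y z.
by case: x y z {fx} => [a|] [b|] [c|] //=; rewrite ge_max => -> ->.
Qed.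

Lemma sum_trop_attained (I : finType) (f : I -> trop R) :
  \sum_j f j != 0 -> exists i, \sum_j f j = f i.
Proof.
have : \sum_j f j = 0 \/ exists i, \sum_j f j = f i.
  elim/big_rec: _ => [|i x _ [->|[j ->]]]; first by left.
  - by right; exists i; rewrite addr0.
  right; case fi: (f i) => [a|]; case fj: (f j) => [b|].
  - have [ab|ba] := leP a b; [exists j|exists i]; rewrite ?fi ?fj;
    congr Some => /=.
      by apply/max_idPr.
    by apply/max_idPl/ltW.
  - by exists i.
  - by exists j.
  by exists i.
by case=> [->|//]; rewrite eqxx.
Qed.

Lemma idempotent_transitive n (E : 'M[trop R]_n) : E *m E = E ->
  forall i j k, le_trop (E i k * E k j) (E i j).
Proof.
move=> EE i j k; rewrite -{3}EE mxE.
exact: (le_trop_sum (fun k => E i k * E k j)).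
Qed.

End TropOrder.

(** * Local units at a reduced idempotent are monomial *)

Section Monomial.
Local Open Scope ring_scope.
Variables (R : realType) (r : nat).
Notation W := (wreath (Algebra.to_multiplicative R) r).
Implicit Types (F : 'M[trop R]_r) (w v : W).

(** In an idempotent with zero diagonal, F i j + F j i >= 0 says that the
    columns [i] and [j] are proportional. *)
Definition reduced F : Prop :=
  [/\ F *m F = F, forall i, F i i = 1 &
      forall i j, le_trop 1 (F i j * F j i) -> i = j].

(** The pairs (d, s) whose monomial matrix, with entry d_i at (i, s i),
    commutes with F. *)
Definition automorphisms F : set W :=
  [set w : W | forall i j,
     expT (w.1 i) * F (w.2 i) (w.2 j) = F i j * expT (w.1 j)]%classic.

(** The product of the monomial matrix of [w] with F. *)
Definition monomial_mx F w : 'M[trop R]_r :=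
  \matrix_(i, j) (expT (w.1 i) * F (w.2 i) j).

Lemma monomial_mx1 F : monomial_mx F 1%g = F.
Proof. by apply/matrixP=> i j; rewrite mxE ffunE perm1 mul1r. Qed.

Lemma monomial_mxM F w v : F *m F = F -> automorphisms F v ->
  monomial_mx F (w * v)%g = monomial_mx F w *m monomial_mx F v.
Proof.
move=> FF Fv; apply/matrixP=> i j; rewrite !mxE /= ffunE permM.
rewrite -[in LHS]FF mxE big_distrr /= (reindex_inj (@perm_inj _ v.2)) /=.
apply: eq_bigr => k _; rewrite !mxE.
rewrite mulrA -(mulrA _ _ (_ * F _ _)) (mulrA (F _ k)) -Fv.
rewrite expTM; ring.
Qed.

Lemma automorphismsV F w : automorphisms F w -> automorphisms F w^-1%g.
Proof.
move=> Fw i j; rewrite /= !ffunE.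
have := Fw (w.2^-1 i)%g (w.2^-1 j)%g; rewrite !permKV => Fij.
set a := w.1 _ in Fij *; set b := w.1 _ in Fij *.
apply: (@expT_mulI _ a); rewrite [LHS]mulrA expTV mul1r.
by rewrite [RHS]mulrA Fij -mulrA expTV mulr1.
Qed.

(** Let X be a local unit with inverse Y. The diagonal entry 0 of X Y at [i]
    is attained at some s i, and [s] is injective because F is reduced.
    Comparing X = X F with F = Y X, and X = F X with F = X Y, along the finite
    entries X_{i, s i} = d_i and Y_{s i, i} = - d_i forces every entry of X,
    once by rows and once by columns; equating the two expressions says that
    (d, s) commutes with F. *)
Theorem local_units_reduced F (K : groupType) : reduced F ->
  isomorphic_to (@mul W) (automorphisms F) K ->
  isomorphic_to mulmx (local_units mulmx F) K.
Proof.
move=> [FF F1 Fred].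
apply: (@isomorphic_trans _ _ _ _ _ _ _ (monomial_mx F)).
- move=> w v /set_mem Fw /set_mem Fv /matrixP wv.
  have w2v2 i : w.2 i = v.2 i.
    apply: Fred; have := wv i (w.2 i); have := wv i (v.2 i); rewrite !mxE !F1.
    case: (F _ _) => [a|] //; case: (F _ _) => [b|] // [ha] [hb] /=.
    by rewrite le0r; move: ha hb => /=; lra.
  have {}w2v2 : w.2 = v.2 by apply/permP.
  have w1v1 : w.1 = v.1.
    apply/ffunP=> i; have := wv i (w.2 i); rewrite !mxE -w2v2 F1 !mulr1.
    exact: expT_inj.
  by move: w1v1 w2v2; case: (w) (v) => [w1 w2] [v1 v2] /= -> ->.
- by move=> w v _ Fv; apply: monomial_mxM.
apply/seteqP; split=> [_ [w Fw <-]|X [FX XF [Y [FY YF XY YX]]]].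
  have F1a : automorphisms F 1%g.
    by move=> i j; rewrite /= !ffunE !perm1 mul1r mulr1.
  have FVa := automorphismsV Fw.
  have uw u : automorphisms F u ->
      F *m monomial_mx F u = monomial_mx F u /\ monomial_mx F u *m F =
        monomial_mx F u.
    move=> Fu; have := monomial_mxM u FF F1a; have := monomial_mxM 1%g FF Fu.
    by rewrite mul1g mulg1 monomial_mx1.
  have [? ?] := uw _ Fw; have [? ?] := uw _ FVa.
  split=> //; exists (monomial_mx F w^-1%g).
  by split=> //; rewrite -monomial_mxM // ?mulgV ?mulVg monomial_mx1.
have leM (U V W : 'M[trop R]_r) : U *m V = W ->
    forall i j k, le_trop (U i k * V k j) (W i j).
  by move=> <- i j k; rewrite mxE; apply: (le_trop_sum (fun k =>
    U i k * V k j)).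
have ex_s i : exists k, X i k * Y k i = 1.
  have := F1 i; rewrite -XY mxE => s1.
  have [|k] := @sum_trop_attained R _ (fun k => X i k * Y k i);
    first by rewrite s1.
  by rewrite s1 => ->; exists k.
have [s Xs] := choice ex_s.
have ex_d i : exists d : R, X i (s i) = expT d /\ Y (s i) i = expT (- d).
  move: (Xs i); case: (X _ _) => [a|] //; case: (Y _ _) => [b|] // [ab].
  by exists a; split=> //; congr Some; rewrite -[RHS]addr0 -ab addKr.
have [d Xd] := choice ex_d.
have s_inj : injective s.
  move=> i j sij; apply: Fred.
  have := le_trop_mul (leM _ _ _ XY i j (s i)) (leM _ _ _ XY j i (s i)).
  rewrite {2 3}sij !(proj1 (Xd _)) !(proj2 (Xd _)).
  by apply: le_trop_trans => /=; lra.
(* Rows of X are shifted rows of F, and columns of X shifted columns of F. *)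
have X_l i j : X i j = expT (d i) * F (s i) j.
  apply: le_trop_anti; last by rewrite -(proj1 (Xd i)); apply: (leM _ _ _ XF).
  rewrite -(le_trop_expM (- d i)) expTK -(proj2 (Xd i)).
  exact: (leM _ _ _ YX).
have X_r i j : X j (s i) = expT (d i) * F j i.
  apply: le_trop_anti; last first.
    by rewrite mulrC -(proj1 (Xd i)); apply: (leM _ _ _ FX).
  rewrite -(le_trop_expM (- d i)) expTK mulrC -(proj2 (Xd i)).
  exact: (leM _ _ _ XY).
exists ([ffun i => d i], perm s_inj).
  by move=> i j; rewrite /= !permE !ffunE -X_l X_r mulrC.
by apply/matrixP=> i j; rewrite mxE /= permE ffunE X_l.
Qed.

End Monomial.

(** * Automorphisms of a block sum *)

Section BlockSum.
Local Open Scope ring_scope.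
Variables (R : realType) (z : nat) (h m : 'I_z -> nat).

(** [place] enumerates the points of a block sum: a class [a], one of its [h
    a] copies, and one of the [m a] points of the block. *)
Definition place : finType := {a : 'I_z & 'I_(h a) * 'I_(m a)}%type.
Definition mkplace a (i : 'I_(h a)) (x : 'I_(m a)) : place :=
  Tagged (fun a => 'I_(h a) * 'I_(m a))%type (i, x).
Definition block (p : place) : {a : 'I_z & 'I_(h a)} :=
  Tagged (fun a => 'I_(h a)) (tagged p).1.

Lemma mkplace_inj a i i' (x x' : 'I_(m a)) :
  mkplace i x = mkplace i' x' -> i = i' /\ x = x'.
Proof. by move=> /eqP; rewrite eq_Tagged /= => /eqP[]. Qed.

Lemma block_inj a (i i' : 'I_(h a)) (x x' : 'I_(m a)) :
  block (mkplace i x) = block (mkplace i' x') -> i = i'.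
Proof. by move=> /eqP; rewrite /block /= eq_Tagged => /eqP. Qed.

Lemma block_eqP p q : block p = block q ->
  exists a (i : 'I_(h a)) x y, p = mkplace i x /\ q = mkplace i y.
Proof.
case: p q => a [i x] [b [j y]] /= e; have /= ab := congr1 tag e.
case: b / ab j y e => j y /eqP; rewrite /block /= eq_Tagged => /eqP /= ij.
by exists a, i, x, y; rewrite ij.
Qed.

(** Connectedness of the graph of finite entries, in the form in which it is
    used: a function that does not vary along edges is constant. *)
Definition connected_kernel k (B : 'I_k -> 'I_k -> trop R) : Prop :=
  forall f : 'I_k -> bool,
    (forall x y, B x y != 0 -> f x = f y) -> forall x y, f x = f y.

Lemma connected_kernel_const k (B : 'I_k -> 'I_k -> trop R) (X : Type) (f :
  'I_k -> X) :
  connected_kernel B -> (forall x y, B x y != 0 -> f x = f y) ->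
  forall x y, f x = f y.
Proof.
move=> conn fB x y; apply/asboolP.
rewrite -(conn (fun y => `[< f x = f y >]) _ x y); first by apply/asboolP.
by move=> x' y' /fB ->.
Qed.

Variables (G : 'I_z -> finGroupType) (r : nat).
Variables (B : forall a, 'I_(m a) -> 'I_(m a) -> trop R) (F : 'M[trop R]_r).
Variables (psi : place -> 'I_r) (psi' : 'I_r -> place).
Variable iota : forall a, G a -> 'S_(m a).
Arguments iota : clear implicits.

Hypothesis m_gt0 : forall a, (0 < m a)%N.
Hypotheses (psiK : cancel psi psi') (psi'K : cancel psi' psi).
Hypothesis F_in : forall a (i : 'I_(h a)) x y,
  F (psi (mkplace i x)) (psi (mkplace i y)) = B x y.
Hypothesis F_out : forall p q, block p != block q -> F (psi p) (psi q) = 0.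
Hypothesis B_conn : forall a, connected_kernel (@B a).
Hypothesis iotaM : forall a, {morph iota a : g g' / (g * g')%g >-> (g * g')%g}.
Hypothesis iota_inj : forall a, injective (iota a).
Hypothesis iota_pres : forall a g x y, B (iota a g x) (iota a g y) = B x y.
Hypothesis iota_surj : forall a (s : 'S_(m a)),
  (forall x y, B (s x) (s y) = B x y) -> exists g, iota a g = s.
(* These two hypotheses leave an automorphism no freedom beyond permuting the
   copies inside each class and acting on each of them through [G]. *)
Hypothesis F_rigid : forall w, automorphisms F w ->
  forall i j, F (w.2 i) (w.2 j) = F i j.
Hypothesis F_class : forall w, automorphisms F w ->
  forall p, tag (psi' (w.2 (psi p))) = tag p.

Notation K := (product_of_wreaths R h G).
Notation W := (wreath (Algebra.to_multiplicative R) r).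

Let iota1 a : iota a 1%g = 1%g.
Proof. by apply: (@mulgI _ (iota a 1%g)); rewrite -iotaM !mulg1. Qed.

(* The natural action of the product of wreath products on the points. *)
Let act (u : K) (p : place) : place :=
  mkplace ((u (tag p)).2 (tagged p).1)
          (iota (tag p) ((u (tag p)).1 (tagged p).1).2 (tagged p).2).

Let prodM (u v : K) a : (u * v)%g a = (u a * v a)%g.
Proof. exact: ffunE. Qed.

Let actM (u v : K) p : act (u * v)%g p = act v (act u p).
Proof. by rewrite /act prodM /= ffunE permM iotaM permM. Qed.

Let act1 p : act 1%g p = p.
Proof.
case: p => a [i x]; rewrite /act /=.
have -> : (1%g : K) a = 1%g by exact: ffunE.
by rewrite /= ffunE perm1 iota1 perm1.
Qed.

Let act_inj u : injective (act u).
Proof. by apply: (@can_inj _ _ _ (act u^-1%g)) => p;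
  rewrite -actM mulgV act1. Qed.

Let block_act u p q : block p = block q -> block (act u p) = block (act u q).
Proof. by move=> /block_eqP[a [i [x [y [-> ->]]]]]. Qed.

Let coords (u : K) : W :=
  ([ffun k => ((u (tag (psi' k))).1 (tagged (psi' k)).1).1],
   perm (inj_comp (can_inj psiK) (inj_comp (@act_inj u) (can_inj psi'K)))).

Let coordsM u v : coords (u * v)%g = (coords u * coords v)%g.
Proof.
congr (_, _); last by apply/permP=> k; rewrite permM !permE /= psiK actM.
by apply/ffunP=> k; rewrite !ffunE !permE /= psiK.
Qed.

Let coords_inj : injective coords.
Proof.
move=> u v uv; apply/ffunP=> a.
have d_eq k := congr1 (fun w : W => w.1 k) uv.
have s_eq k := congr1 (fun w : W => psi' (w.2 k)) uv.
have tg i x : (u a).2 i = (v a).2 i /\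
    iota a ((u a).1 i).2 x = iota a ((v a).1 i).2 x.
  have := s_eq (psi (mkplace i x)); rewrite !permE /= !psiK.
  exact: mkplace_inj.
have x0 := Ordinal (m_gt0 a).
rewrite [LHS]surjective_pairing [RHS]surjective_pairing; congr (_, _).
  apply/ffunP=> i.
  rewrite [LHS]surjective_pairing [RHS]surjective_pairing; congr (_, _).
    by have := d_eq (psi (mkplace i x0)); rewrite !ffunE psiK.
  by apply: iota_inj; apply/permP=> x; have [] := tg i x.
by apply/permP=> i; have [] := tg i x0.
Qed.

Let coords_aut u : automorphisms F (coords u).
Proof.
move=> i j; rewrite -(psi'K i) -(psi'K j) !permE /= !ffunE !psiK.
have [e|ne] := eqVneq (block (psi' i)) (block (psi' j)).
  have [a [k [x [y [-> ->]]]]] := block_eqP e.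
  by rewrite /act /= !F_in iota_pres mulrC.
rewrite !F_out ?mulr0 ?mul0r //; apply: contraNneq ne.
by move=> /(block_act u^-1%g); rewrite -!actM mulgV !act1 => ->.
Qed.

Let F_edge p q : F (psi p) (psi q) != 0 -> block p = block q.
Proof. by move=> nz; apply/eqP; apply: contraNT nz => /F_out ->. Qed.

Let aut_block (w : W) p q : automorphisms F w -> block p = block q ->
  block (psi' (w.2 (psi p))) = block (psi' (w.2 (psi q))).
Proof.
move=> Fw /block_eqP[a [i [x [y [-> ->]]]]]; move: x y.
apply: (connected_kernel_const (@B_conn a)) => x y nz.
by apply: F_edge; rewrite !psi'K F_rigid ?F_in.
Qed.

(* As finite entries are preserved, [w] maps blocks to blocks; the copy
   reached defines the permutation [t], and the induced map of blocks an
   element of [G]. *)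
Let coords_surj w : automorphisms F w -> exists u, coords u = w.
Proof.
move=> Fw; pose sg p := psi' (w.2 (psi p)).
have sg_inj : injective sg.
  by move=> p q /(can_inj psi'K)/perm_inj/(can_inj psiK).
have d_const a (i : 'I_(h a)) x y :
    w.1 (psi (mkplace i x)) = w.1 (psi (mkplace i y)).
  move: x y; apply: (connected_kernel_const (@B_conn a)) => x y.
  rewrite -(F_in i); have := Fw (psi (mkplace i x)) (psi (mkplace i y)).
  rewrite F_rigid //; case: (F _ _) => [c|] // [e] _; move: e.
  by rewrite [RHS]addrC; apply: addIr.
have x0 a : 'I_(m a) := Ordinal (m_gt0 a).
have ex_t a (i : 'I_(h a)) : exists j : 'I_(h a), forall x, exists y,
    sg (mkplace i x) = mkplace j y.
  have := F_class Fw (mkplace i (x0 a)); rewrite -/(sg _).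
  case e0: (sg (mkplace i (x0 a))) => [b [j y0]] /= ba.
  case: a / ba i e0 => i e0.
  exists j => x.
  have : block (sg (mkplace i x)) = block (sg (mkplace i (x0 b))).
    exact: aut_block.
  rewrite e0; case: (sg _) => c [k y] /= e; have /= /esym cb := congr1 tag e.
  case: c / cb k y e => k y /eqP; rewrite /block eq_Tagged /= => /eqP ->.
  by exists y.
pose t a i := projT1 (cid (ex_t a i)).
have ex_g a (i : 'I_(h a)) x : exists y, sg (mkplace i x) = mkplace (t a i) y.
  exact: (projT2 (cid (ex_t a i))).
pose g a i x := projT1 (cid (ex_g a i x)).
have sgE a (i : 'I_(h a)) x : sg (mkplace i x) = mkplace (t a i) (g a i x).
  exact: (projT2 (cid (ex_g a i x))).
have t_inj a : injective (t a).
  move=> i i' e; apply: (@block_inj a i i' (x0 a) (x0 a)).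
  have /(aut_block (automorphismsV Fw)) :
      block (sg (mkplace i (x0 a))) = block (sg (mkplace i' (x0 a))).
    by rewrite !sgE /block /= e.
  by rewrite /sg !psi'K /= !permK !psiK.
have g_inj a i : injective (g a i).
  move=> x x' e; have /sg_inj/mkplace_inj[] // :
    sg (mkplace i x) = sg (mkplace i x').
  by rewrite !sgE e.
have ex_gam a i : exists c, iota a c = perm (@g_inj a i).
  apply: iota_surj => x y; rewrite !permE.
  by rewrite -(F_in (t a i)) -!sgE /sg !psi'K F_rigid ?F_in.
pose gam a i := projT1 (cid (ex_gam a i)).
have gamE a i : iota a (gam a i) = perm (@g_inj a i).
  exact: (projT2 (cid (ex_gam a i))).
pose u : K := [ffun a =>
  (([ffun i => ((w.1 (psi (mkplace i (x0 a))) : Algebra.to_multiplicative R),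
    gam a i)],
    perm (@t_inj a)) : wreath _ _)].
exists u; rewrite [RHS]surjective_pairing; congr (_, _).
  apply/ffunP=> k; rewrite ffunE -[in RHS](psi'K k).
  by case: (psi' k) => a [i x]; rewrite /= /u !ffunE /=; apply: d_const.
apply/permP=> k; rewrite permE /= -[in RHS](psi'K k) -[RHS]psi'K.
rewrite -/(sg _); congr psi.
by case: (psi' k) => a [i x]; rewrite [RHS]sgE /act /= /u !ffunE /= gamE !permE.
Qed.

(** Along a finite entry that is preserved exactly, the gauge does not change;
    it is therefore an arbitrary real number on each block. *)
Theorem automorphisms_block_sum :
  isomorphic_to (@mul W) (automorphisms F) K.
Proof.
exists coords; split; [exact: coords_inj|exact: coordsM|].
apply/seteqP; split=> [_ [u _ <-]|w /coords_surj[u <-]];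
  first exact: coords_aut.
by exists u.
Qed.

End BlockSum.

(** * Reducing an idempotent *)

Section Reduction.
Local Open Scope ring_scope.
Variables (R : realType) (n : nat) (E : 'M[trop R]_n).
Hypothesis EE : E *m E = E.

Let Etrans := idempotent_transitive EE.

(** Since E = E E, a finite entry E i j splits at some point f(i), the entry E
    (f i) j splits at f(f(i)), and so on. These iterates repeat: at a repeated
    point [v] the cycle gives E v j <= E v v + E v j, whence E v v = 0. *)
Lemma idempotent_factor_diag i j : E i j != 0 ->
  exists2 v, E v v = 1 & le_trop (E i j) (E i v * E v j).
Proof.
move=> Eij.
have ex_f k : exists l, E k j != 0 -> E k j = E k l * E l j.
  have := @sum_trop_attained R _ (fun l => E k l * E l j).
  have -> : \sum_l E k l * E l j = E k j by rewrite -[in RHS]EE mxE.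
  have [->|nz /(_ isT)[l ->]] := eqVneq (E k j) 0; first by exists k.
  by exists l.
have [f fE] := choice ex_f.
have step k s : E k j != 0 ->
    le_trop (E k j) (E k (iter s.+1 f k) * E (iter s.+1 f k) j) /\
    E (iter s.+1 f k) j != 0.
  move=> nz; have nzr l : le_trop (E k j) (E k l * E l j) -> E l j != 0.
    by move=> le_l; apply: contraNneq nz => lj0; move: le_l;
      rewrite lj0 mulr0; case: (E k j).
  elim: s => [|s [IH nz_s]].
    have le1 : le_trop (E k j) (E k (f k) * E (f k) j).
      by rewrite -fE // le_trop_refl.
    by split=> //; apply: nzr le1.
  set l := iter _ _ _ in IH nz_s; rewrite [iter _.+1 _ _]iterS -/l.
  have leS : le_trop (E k j) (E k (f l) * E (f l) j).
    apply: le_trop_trans IH _; rewrite {1}(fE l nz_s) mulrA.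
    by apply: le_trop_mul (Etrans _ _ _) (le_trop_refl _).
  by split=> //; apply: nzr leS.
have [inj|] := boolP (injectiveb (fun t : 'I_n.+1 => iter t.+1 f i)).
  by have := leq_card _ (injectiveP _ inj); rewrite !card_ord ltnn.
move=> /injectivePn[t [t' tt' vE]].
wlog lt_tt' : t t' tt' vE / (t < t')%N.
  move=> wl; have [lt|lt|/val_inj/eqP] := ltngtP t t';
    last by rewrite (negPf tt').
    exact: wl lt.
  by apply: wl lt; rewrite // eq_sym.
set v := iter t.+1 f i in vE.
have [ivj nzv] := step i t Eij.
exists v => //.
have [] := step v (t' - t).-1 nzv.
have -> : iter (t' - t).-1.+1 f v = v.
  by rewrite -iterD [RHS]vE; congr (iter _ f i); lia.
have := Etrans v v v; move: nzv; rewrite -/v.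
case: (E v j) => [b|] // _; case: (E v v) => [a|] //= aa bab _.
by congr Some; apply/le_anti; lra.
Qed.

(* On the indices with E v v = 0, [equiv] is proportionality of columns, and
   [reps] picks the smallest index of each class. *)
Let equiv v w := le_trop 1 (E v w * E w v).

Let equiv_trans v w u : equiv v w -> equiv w u -> equiv v u.
Proof.
rewrite /equiv => vw wu; have := le_trop_mul vw wu;
  rewrite mulr1 => /le_trop_trans; apply.
have -> : E v w * E w v * (E w u * E u w) = (E v w * E w u) * (E u w * E w v)
  by ring.
exact: le_trop_mul.
Qed.

Let reps : {set 'I_n} := [set v | (E v v == 1) &&
  [forall w, (E w w == 1) ==> equiv v w ==> (v <= w)%N]].

Let ex_rep v : E v v = 1 -> exists2 w, w \in reps & equiv v w.
Proof.
move=> v1; have Qv : (E v v == 1) && equiv v v.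
  by rewrite /equiv v1 eqxx mulr1 le_trop_refl.
case: (@arg_minnP _ v (fun w => (E w w == 1) && equiv v w) val Qv).
move=> w /andP[w1 vw] wmin; exists w => //; rewrite inE w1.
apply/forallP=> u; apply/implyP=> u1; apply/implyP=> wu.
by apply: wmin; rewrite u1 (equiv_trans vw).
Qed.

(** The columns and rows at [reps] already generate E: a splitting point [v]
    can be replaced by the representative of its proportionality class. *)
Theorem reduce_idempotent : exists r (A : 'M_(n, r)) (B : 'M_(r, n)),
  [/\ (r <= n)%N, A *m B = E & reduced (B *m A)].
Proof.
pose phi := @enum_val _ (mem reps).
exists #|reps|, (colsub phi E), (rowsub phi E).
have BA : rowsub phi E *m colsub phi E = mxsub phi phi E.
  by rewrite -mxsub_mul EE.
split; first by rewrite -[X in (_ <= X)%N](card_ord n) max_card.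
  apply/matrixP=> i j; rewrite mxE; apply: le_trop_anti.
    by apply: sum_trop_le => k; rewrite !mxE.
  have [->//|/idempotent_factor_diag[v v1 ivj]] := eqVneq (E i j) 0.
  have [w wV vw] := ex_rep v1; apply: le_trop_trans ivj _.
  have := @le_trop_sum R _ (fun k => colsub phi E i k * rowsub phi E k j)
    (enum_rank_in wV w).
  rewrite !mxE /phi enum_rankK_in //; apply: le_trop_trans.
  have := le_trop_mul vw (le_trop_refl (E i v * E v j)); rewrite mul1r.
  move=> /le_trop_trans; apply.
  have -> : E v w * E w v * (E i v * E v j) = (E i v * E v w) * (E w v * E v
    j) by ring.
  exact: le_trop_mul.
have phiV k : phi k \in reps by apply: enum_valP.
have phi1 k : E (phi k) (phi k) = 1 by have := phiV k;
  rewrite inE => /andP[/eqP].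
rewrite BA; split.
- apply/matrixP=> k l; rewrite !mxE; apply: le_trop_anti.
    by apply: sum_trop_le => i; rewrite !mxE.
  have := @le_trop_sum R _ (fun i => mxsub phi phi E k i * mxsub phi phi E i
    l) k.
  by rewrite !mxE phi1 mul1r.
- by move=> k; rewrite mxE.
move=> k l; rewrite !mxE -/(equiv _ _) => kl; apply: enum_val_inj;
  apply/val_inj/anti_leq.
have := phiV k; have := phiV l; rewrite !inE -/phi.
move=> /andP[_ /forallP/(_ (phi k))]; rewrite phi1 eqxx /equiv mulrC -/(equiv
  _ _) kl !implyTb => ->.
by move=> /andP[_ /forallP/(_ (phi l))]; rewrite phi1 eqxx -/(equiv _ _) kl
  !implyTb andbT.
Qed.

End Reduction.

(** * Averaging *)

Section Averaging.
Local Open Scope ring_scope.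
Variables (R : realType) (r : nat).
Notation W := (wreath (Algebra.to_multiplicative R) r).

Definition rigid (F : 'M[trop R]_r) : Prop := forall w : W,
  automorphisms F w -> forall i j, F (w.2 i) (w.2 j) = F i j.

Lemma automorphismsM (F : 'M[trop R]_r) (w v : W) :
  automorphisms F w -> automorphisms F v -> automorphisms F (w * v)%g.
Proof.
move=> Fw Fv i j; rewrite /= !ffunE !permM !expTM -mulrA Fv mulrA Fw.
by rewrite mulrA.
Qed.

Variable F : 'M[trop R]_r.

(* The permutations that occur in automorphisms, a finite group. *)
Let Gam : {set 'S_r} :=
  [set s | `[< exists2 w : W, automorphisms F w & w.2 = s >]].

Let GamP (w : W) : automorphisms F w -> w.2 \in Gam.
Proof. by move=> Fw; rewrite inE; apply/asboolP; exists w. Qed.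

Let Gam_ex s : s \in Gam -> exists2 w : W, automorphisms F w & w.2 = s.
Proof. by rewrite inE => /asboolP. Qed.

Let GamM s t : s \in Gam -> t \in Gam -> (s * t)%g \in Gam.
Proof.
move=> /Gam_ex[w Fw <-] /Gam_ex[v Fv <-].
by apply: (@GamP (w * v)%g); apply: automorphismsM.
Qed.

Let GamV s : s \in Gam -> s^-1%g \in Gam.
Proof.
move=> /Gam_ex[w Fw <-].
by apply: (@GamP w^-1%g); apply: automorphismsV.
Qed.

Let Gam1 : 1%g \in Gam.
Proof.
apply: (@GamP 1%g) => i j; rewrite /= !ffunE !perm1 mulr1.
by rewrite mul1r.
Qed.

Let Gam_sum (f : 'S_r -> R) s : s \in Gam ->
  \sum_(t in Gam) f (s * t)%g = \sum_(t in Gam) f t.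
Proof.
move=> sG; rewrite [RHS](reindex_inj (@mulgI _ s)); apply: eq_bigl => t.
apply/idP/idP => [|stG]; first exact: GamM.
by rewrite -(mulKg s t); apply: GamM => //; apply: GamV.
Qed.

(** Choose a gauge [d s] for every [s] that occurs, and conjugate F by the
    mean [u] of these gauges. The value at a finite entry (i, j) becomes the
    mean of the values F (s i) (s j), which is invariant; the choices of the
    [d s] need not be coherent for this. *)
Lemma average_idempotent : reduced F -> exists A B : 'M[trop R]_r,
  [/\ A *m B = F, reduced (B *m A) & rigid (B *m A)].
Proof.
move=> [FF F1 Fred].
have ex_d s : exists d : {ffun 'I_r -> R},
    s \in Gam -> automorphisms F ((d, s) : W).
  have [|nG] := boolP (s \in Gam); last by exists [ffun=> 0].
  by move=> /Gam_ex[[d t] Fd /= <-]; exists d.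
have [d Fd] := choice ex_d.
pose c : R := #|Gam|%:R.
have c0 : c != 0 by rewrite pnatr_eq0 -lt0n; apply/card_gt0P; exists 1%g;
  apply: Gam1.
pose u i : R := c^-1 * \sum_(s in Gam) d s i.
pose A : 'M_r := \matrix_(i, k) (F i k * expT (u k)).
pose B : 'M_r := \matrix_(k, j) (expT (- u k) * F k j).
have eu k : expT (- u k) * expT (u k) = 1 by rewrite -expTD addNr.
have AB : A *m B = F.
  rewrite -[RHS]FF; apply/matrixP=> i j; rewrite !mxE; apply: eq_bigr => k _.
  by rewrite !mxE mulrA -(mulrA (F i k)) (mulrC (expT (u k))) eu mulr1.
have BA i j : (B *m A) i j = expT (- u i) * F i j * expT (u j).
  rewrite -[in RHS]FF !mxE big_distrr big_distrl /=; apply: eq_bigr => k _.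
  by rewrite !mxE !mulrA.
have BF : B *m F = B.
  apply/matrixP=> i j; rewrite !mxE -[in RHS]FF mxE big_distrr /=.
  by apply: eq_bigr => k _; rewrite !mxE mulrA.
exists A, B; split=> //.
  split; first by rewrite !mulmxA -(mulmxA B A B) AB BF.
    by move=> i; rewrite BA F1 mulr1 eu.
  move=> i j; rewrite !BA => le1; apply: Fred; apply: le_trop_trans le1 _.
  have -> : expT (- u i) * F i j * expT (u j) * (expT (- u j) * F j i * expT
    (u i)) =
     (expT (- u i) * expT (u i)) * (expT (- u j) * expT (u j)) * (F i j * F j
       i) by ring.
  by rewrite !eu !mul1r le_trop_refl.
(* The mean on the right-hand side is visibly invariant under [Gam]. *)
have mean i j : F i j != 0 ->
    (B *m A) i j = expT (c^-1 * \sum_(s in Gam) odflt 0 (F (s i) (s j))).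
  case Fij: (F i j) => [a|] // _; rewrite BA Fij; congr Some => /=.
  rewrite (eq_bigr (fun s => a + d s j - d s i)); last first.
    move=> s sG; have /= := Fd s sG i j; rewrite Fij.
    by case: (F _ _) => [b|] // [e] /=; rewrite -e; lra.
  rewrite sumrB big_split /= sumr_const -[a *+ _]mulr_natl -/c /u.
  by rewrite mulrBr mulrDr mulKf //; lra.
move=> w Fw; have wG : w.2 \in Gam.
  apply: (@GamP ([ffun i => w.1 i + u i - u (w.2 i)], w.2)) => i j /=.
  rewrite !ffunE; have := Fw i j; rewrite !BA.
  case: (F i j) => [a|]; case: (F _ _) => [b|] // [e]; congr Some => /=.
  by move: e; rewrite /=; lra.
move=> i j; have [Fij|nz] := eqVneq (F i j) 0.
  rewrite !BA; have := Fd _ wG i j; rewrite Fij.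
  by case: (F _ _).
rewrite !mean //; last first.
  have := Fd _ wG i j; case: (F _ _) => //.
  by case: (F i j) nz.
congr expT; congr (_ * _); rewrite -(Gam_sum (fun s =>
  odflt 0 (F (s i) (s j))) wG).
by apply: eq_bigr => s _; rewrite !permM.
Qed.

End Averaging.

(** * Components of a rigid reduced idempotent *)

Section KernelGroup.
Local Open Scope ring_scope.
Variables (R : realType) (k : nat) (B : 'I_k -> 'I_k -> trop R).

Definition kernel_stab : {set 'S_k} :=
  [set s : 'S_k | [forall x, forall y, B (s x) (s y) == B x y]].

Lemma kernel_stabP (s : 'S_k) :
  reflect (forall x y, B (s x) (s y) = B x y) (s \in kernel_stab).
Proof.
rewrite inE; apply: (iffP forallP) => [H x y|H x]; last by apply/forallP=> y;
  apply/eqP.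
exact/eqP/(forallP (H x)).
Qed.

Fact kernel_stab_group : group_set kernel_stab.
Proof.
apply/group_setP; split; first by apply/kernel_stabP=> x y; rewrite !perm1.
move=> s t /kernel_stabP Bs /kernel_stabP Bt; apply/kernel_stabP=> x y.
by rewrite !permM Bt Bs.
Qed.

Canonical kernel_stab_Group := Group kernel_stab_group.

(** Along an orbit of pairs of its stabiliser a kernel is constant, so
    whatever preserves the orbits preserves the kernel. *)
Lemma kernel_stab_two_closed : two_closed kernel_stab_Group.
Proof.
move=> s sP; apply/kernel_stabP=> x y.
have: (s x, s y) \in pair_orbit kernel_stab_Group (x, y).
  rewrite -(sP (x, y)); apply/imsetP; exists (x, y) => //.
  by apply/imsetP; exists 1%g; rewrite ?group1 // /pair_act !perm1.
by case/imsetP=> g /kernel_stabP Bg [-> ->]; rewrite Bg.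
Qed.

End KernelGroup.

Section Components.
Local Open Scope ring_scope.
Variables (R : realType) (r : nat) (F : 'M[trop R]_r).
Notation W := (wreath (Algebra.to_multiplicative R) r).
Hypotheses (F1 : forall i, F i i = 1) (Frig : rigid F).

Let Gam := kernel_stab_Group F.
Let GamP (s : 'S_r) := kernel_stabP F s.

Let aut_Gam (w : W) : automorphisms F w -> w.2 \in Gam.
Proof. by move=> Fw; apply/GamP/Frig. Qed.

Definition linked : rel 'I_r := [rel i j | (F i j != 0) || (F j i != 0)].
Let linked_sym : symmetric linked.
Proof. by move=> i j; rewrite /linked /= orbC. Qed.
Let conn := connect linked.
Let conn_sym : symmetric conn := sym_connect_sym linked_sym.
Let conn0 i : conn i i := connect0 linked i.
Let conn_trans i j k : conn i j -> conn j k -> conn i k :=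
  @connect_trans _ linked j i k.

Let F_conn i j : F i j != 0 -> conn i j.
Proof. by move=> Fij; apply: connect1; rewrite /linked /= Fij. Qed.

Let Gam_conn (s : 'S_r) i j : s \in Gam -> conn i j -> conn (s i) (s j).
Proof.
move=> /GamP Fs /connectP[p pp ->]; apply/connectP; exists (map s p).
  by rewrite path_map; apply: sub_path pp => x y; rewrite /linked /= !Fs.
by rewrite last_map.
Qed.

Let comp i : {set 'I_r} := [set j | conn i j].

Let compE i j : (comp i == comp j) = conn i j.
Proof.
apply/eqP/idP => [/setP/(_ j)|ij]; first by rewrite !inE => ->; apply: conn0.
apply/setP=> k; rewrite !inE; apply/idP/idP; apply: conn_trans => //.
by rewrite conn_sym.
Qed.

(* Two points are akin when [Gam] moves the component of one to that of the
   other. *)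
Let akin i j := [exists s : 'S_r, (s \in Gam) && conn (s i) j].
Let akin_conn i j : conn i j -> akin i j.
Proof. by move=> ij; apply/existsP; exists 1%g; rewrite group1 perm1. Qed.
Let akin_Gam (s : 'S_r) i : s \in Gam -> akin i (s i).
Proof. by move=> sG; apply/existsP; exists s; rewrite sG conn0. Qed.
Let akin_sym i j : akin i j -> akin j i.
Proof.
case/existsP=> s /andP[sG /(Gam_conn (groupVr sG))]; rewrite permK => ij.
by apply/existsP; exists s^-1%g; rewrite groupV sG conn_sym.
Qed.
Let akin_trans i j k : akin i j -> akin j k -> akin i k.
Proof.
case/existsP=> s /andP[sG ij] /existsP[t /andP[tG jk]].
apply/existsP; exists (s * t)%g; rewrite groupM //= permM.
exact: conn_trans (Gam_conn tG ij) jk.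
Qed.

(* A canonical point of the kinship class of [i]: the predicate [akin i], and
   with it the result of [pick], depends only on the class. *)
Let base i := odflt i [pick j | akin i j].
Let base_akin i : akin i (base i).
Proof.
rewrite /base; case: pickP => [j //|] /(_ i).
by rewrite akin_conn ?conn0.
Qed.
Let base_eq i j : akin i j -> base i = base j.
Proof.
move=> ij; have ij_ik : akin i =1 akin j.
  by move=> k; apply/idP/idP; apply: akin_trans => //; apply: akin_sym.
rewrite /base -(eq_pick ij_ik); case: pickP => [//|] /(_ i).
by rewrite akin_conn ?conn0.
Qed.

Let bases := [set i | base i == i].
Let base_bases i : base i \in bases.
Proof. by rewrite inE; apply/eqP/esym/base_eq/base_akin. Qed.

Definition num_classes := #|bases|.
Let pt (a : 'I_num_classes) : 'I_r := enum_val a.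
Let pt_base a : base (pt a) = pt a.
Proof. by have := enum_valP a; rewrite inE => /eqP. Qed.
Let pt_akin a b : akin (pt a) (pt b) -> a = b.
Proof. by move/base_eq; rewrite !pt_base; apply: enum_val_inj. Qed.

Definition class_size (a : 'I_num_classes) := #|comp (pt a)|.
Let blocks (a : 'I_num_classes) := [set comp (s (pt a)) | s : 'S_r in Gam].
Definition class_count (a : 'I_num_classes) := #|blocks a|.

(* One element of [Gam] for every component of a class, moving the component
   of the base point onto it, so that all copies carry the same kernel. *)
Let ex_gam a (i : 'I_(class_count a)) :
  exists s : 'S_r, s \in Gam /\ comp (s (pt a)) = enum_val i.
Proof. by have /imsetP[s sG ->] := enum_valP i; exists s. Qed.
Let gam a (i : 'I_(class_count a)) : 'S_r := projT1 (cid (@ex_gam a i)).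
Let gamP a (i : 'I_(class_count a)) :
  @gam a i \in Gam /\ comp (@gam a i (pt a)) = enum_val i.
Proof. exact: (projT2 (cid (@ex_gam a i))). Qed.

Definition class_kernel (a : 'I_num_classes) (x y : 'I_(class_size a)) :
  trop R :=
  F (enum_val x) (enum_val y).
Definition class_group (a : 'I_num_classes) : finGroupType :=
  subg_of (kernel_stab_Group (@class_kernel a)).

Let psi (p : place class_count class_size) : 'I_r :=
  @gam (tag p) (tagged p).1 (enum_val (tagged p).2).

Let psi_comp p : comp (psi p) = enum_val (tagged p).1.
Proof.
case: p => a [i x]; rewrite /psi /=; have [gG <-] := gamP i.
apply/eqP; rewrite compE; apply: Gam_conn => //.
by have := enum_valP x; rewrite inE conn_sym.
Qed.

Let psi_akin p : akin (pt (tag p)) (psi p).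
Proof.
case: p => a [i x]; rewrite /psi /=; have [gG _] := gamP i.
apply: akin_trans (akin_Gam _ gG); apply: akin_conn.
by have := enum_valP x; rewrite inE.
Qed.

Let psi_block p q : conn (psi p) (psi q) -> block p = block q.
Proof.
move=> pq; have : tag p = tag q.
  apply: pt_akin; apply: akin_trans (psi_akin p) _.
  by apply: akin_trans (akin_conn pq) _; apply/akin_sym/psi_akin.
move: pq; rewrite -compE => /eqP; rewrite !psi_comp.
case: p q => a [i x] [b [j y]] /= e ab; case: b / ab j y e =>
  j y /enum_val_inj e.
by rewrite /block /= e.
Qed.

Let psi_inj : injective psi.
Proof.
move=> p q pq; have /psi_block/block_eqP[a [i [x [y [ep eq]]]]] :
  conn (psi p) (psi q).
  by rewrite pq conn0.
by move: pq; rewrite ep eq /psi /= => /perm_inj/enum_val_inj ->.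
Qed.

Let psi_surj k : exists p, psi p = k.
Proof.
pose a := enum_rank_in (base_bases k) (base k).
have pa : pt a = base k by rewrite /pt enum_rankK_in.
have /existsP[s /andP[sG sk]] : akin (pt a) k by rewrite pa;
  apply/akin_sym/base_akin.
have sB : comp (s (pt a)) \in blocks a by apply: imset_f.
pose i := enum_rank_in sB (comp (s (pt a))).
have [gG] := gamP i; rewrite enum_rankK_in // => /eqP; rewrite compE => gs.
have kC : ((@gam a i)^-1)%g k \in comp (pt a).
  rewrite inE -[X in conn X _](permK (@gam a i)); apply: Gam_conn;
    first by rewrite groupV.
  exact: conn_trans gs sk.
exists (mkplace i (enum_rank_in kC ((@gam a i)^-1 k)%g)).
by rewrite /psi /= enum_rankK_in // permKV.
Qed.

Let psi' k := projT1 (cid (psi_surj k)).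
Let psi'K : cancel psi' psi.
Proof. by move=> k; apply: (projT2 (cid (psi_surj k))). Qed.
Let psiK : cancel psi psi'.
Proof. by move=> p; apply: psi_inj; rewrite psi'K. Qed.

Lemma class_size_gt0 a : (0 < class_size a)%N.
Proof. by apply/card_gt0P; exists (pt a); rewrite inE conn0. Qed.

Lemma class_count_gt0 a : (0 < class_count a)%N.
Proof. by apply/card_gt0P; exists (comp ((1%g : 'S_r) (pt a)));
  apply: imset_f; apply: group1. Qed.

Lemma num_classes_gt0 : (0 < r)%N -> (0 < num_classes)%N.
Proof. by move=> r0; apply/card_gt0P; exists (base (Ordinal r0)). Qed.

Lemma sum_class_size : (\sum_(a < num_classes) class_size a * class_count a)%N
  = r.
Proof.
have : #|{: place class_count class_size}| = r.
  by rewrite -[RHS]card_ord; apply: bij_eq_card; exists psi';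
    [exact: psiK|exact: psi'K].
rewrite card_tagged sumnE big_map big_enum => sr; rewrite -[RHS]sr.
by apply: eq_bigr => a _; rewrite card_prod !card_ord mulnC.
Qed.

Lemma class_group_two_closed a : two_closed_on (class_group a) (class_size a).
Proof.
exists (kernel_stab_Group (@class_kernel a));
  first exact: kernel_stab_two_closed.
by rewrite isog_sym isog_subg.
Qed.

(** The elements [gam] identify F with the block sum of the kernels of the
    base components. *)
Theorem automorphisms_components :
  isomorphic_to (@mul W) (automorphisms F)
    (product_of_wreaths R class_count class_group).
Proof.
pose iota a (g : class_group a) : 'S_(class_size a) := sgval g.
apply: (@automorphisms_block_sum R num_classes class_count class_size
  class_group r class_kernel F psi psi' iota) => //.
- exact: class_size_gt0.
- by move=> a i x y; have [/GamP gG _] := gamP i; rewrite /psi /= gG.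
- by move=> p q; apply: contraNeq => /F_conn/psi_block ->.
- move=> a f fP; have pC : pt a \in comp (pt a) by rewrite inE conn0.
  pose rk k := enum_rank_in pC k.
  have rkE x : rk (enum_val x) = x by apply: enum_valK_in.
  suff fpt x : f x = f (rk (pt a)) by move=> x y; rewrite !fpt.
  pose S := [pred k | (k \in comp (pt a)) && (f (rk k) == f (rk (pt a)))].
  have Scl : closed linked S.
    apply: intro_closed => // k l kl; rewrite !inE => /andP[kC /eqP <-].
    have lC : conn (pt a) l by apply: conn_trans kC (connect1 kl).
    rewrite lC /= eq_sym; apply/eqP.
    have kE : enum_val (rk k) = k by rewrite enum_rankK_in ?inE.
    have lE : enum_val (rk l) = l by rewrite enum_rankK_in ?inE.
    by case/orP: kl => nz; [|symmetry]; apply: fP; rewrite /class_kernel kE lE.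
  have xC : conn (pt a) (enum_val x) by have := enum_valP x; rewrite inE.
  have := closed_connect Scl xC; rewrite !inE conn0 eqxx xC rkE /=.
  by move/esym/eqP.
- by move=> a; apply: val_inj.
- move=> a g x y; rewrite /iota.
  have /kernel_stabP gB : sgval g \in kernel_stab_Group (@class_kernel a) :=
    subgP g.
  exact: gB.
- by move=> a s /kernel_stabP sH; exists (subg _ s); rewrite /iota subgK.
- move=> w /aut_Gam wG p; apply: pt_akin.
  apply: akin_trans (psi_akin _) _; rewrite psi'K.
  by apply: akin_trans (akin_sym (akin_Gam _ wG)) (akin_sym (psi_akin p)).
Qed.

(** * Coincidences among components with at most two points *)

(* It suffices to look at finite entries: were F (s i) (s j) finite and F i j
   not, the condition at (s i, s j) would be violated, as [s] is an
   involution. *)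
Let involution_aut (d : {ffun 'I_r -> Algebra.to_multiplicative R}) (s : 'S_r) :
  involutive s ->
  (forall i j, F i j != 0 -> expT (d i) * F (s i) (s j) = F i j * expT (d j)) ->
  automorphisms F ((d, s) : W).
Proof.
move=> ss Fds i j /=; have [Fij|/Fds//] := eqVneq (F i j) 0.
rewrite Fij mul0r; have [->|/Fds] := eqVneq (F (s i) (s j)) 0;
  first exact: mulr0.
by rewrite !ss Fij mulr0; case: (F _ _).
Qed.

(* Exchanging two isolated points is an automorphism. *)
Let size1_class_unique a b : class_size a = 1%N -> class_size b = 1%N -> a = b.
Proof.
have single c : class_size c = 1%N -> forall k, conn (pt c) k -> k = pt c.
  move=> /eqP/cards1P[q cq] k ck.
  have kc : k \in comp (pt c) by rewrite inE.
  have pc : pt c \in comp (pt c) by rewrite inE conn0.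
  by move: kc pc; rewrite cq !inE => /eqP-> /eqP->.
move=> /single sa /single sb; apply: pt_akin.
pose s := tperm (pt a) (pt b).
suff /aut_Gam sG : automorphisms F (([ffun => 1%g], s) : W).
  by rewrite -[pt b](tpermL (pt a)) akin_Gam.
apply: involution_aut => [k|i j]; first exact: tpermK.
rewrite !ffunE mulr1 mul1r => /F_conn ij; rewrite /s.
have [ia|nia] := eqVneq i (pt a).
  by move: ij; rewrite ia => /sa ->; rewrite !tpermL !F1.
have [ib|nib] := eqVneq i (pt b).
  by move: ij; rewrite ib => /sb ->; rewrite !tpermR !F1.
have nja : j != pt a by apply: contraNneq nia => ja; apply/eqP/sa;
  rewrite -ja conn_sym.
have njb : j != pt b by apply: contraNneq nib => jb; apply/eqP/sb;
  rewrite -jb conn_sym.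
by rewrite !tpermD // eq_sym.
Qed.

(* If both off-diagonal entries of a two-point component are finite,
   exchanging the two points is an automorphism, as a gauge makes the entries
   equal. *)
Let size2_trivial_oriented a : class_size a = 2%N ->
  [set: class_group a]%g = 1%g ->
  exists i j, [/\ i != j, comp (pt a) = [set i; j],
    exists x, F i j = expT x & F j i = 0].
Proof.
move=> /eqP/cards2P[i [j [ij Cij]]] triv.
have Hi : i \in comp (pt a) by rewrite Cij set21.
have Hj : j \in comp (pt a) by rewrite Cij set22.
have conn_ij : conn i j.
  by move: Hi Hj; rewrite !inE conn_sym; apply: conn_trans.
have stay k l : (k == i) || (k == j) -> F k l != 0 -> (l == i) || (l == j).
  rewrite -!finset.in_set2 -Cij !inE => ck /F_conn; exact: conn_trans ck.
have stay' k l : (l == i) || (l == j) -> F k l != 0 -> (k == i) || (k == j).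
  by rewrite -!finset.in_set2 -Cij !inE => cl /F_conn; rewrite conn_sym;
    apply: conn_trans cl.
case Fij : (F i j) => [x|]; case Fji : (F j i) => [y|].
- have autd : automorphisms F (([ffun k => if k == j then y - x else 0],
  tperm i j) : W).
    apply: involution_aut => [k|k l]; first exact: tpermK.
    rewrite !ffunE; case: (tpermP i j k) => [->|->|/eqP ki /eqP kj].
    + rewrite (negPf ij) => nz; have := stay i l;
      rewrite eqxx => /(_ isT nz) /orP[]/eqP->.
        by rewrite tpermL (negPf ij) mul1r mulr1 !F1.
      by rewrite tpermR eqxx Fij Fji; congr Some => /=; lra.
    + rewrite eqxx => nz; have := stay j l;
      rewrite eqxx orbT => /(_ isT nz) /orP[]/eqP->.
        by rewrite tpermL (negPf ij) Fij Fji; congr Some => /=; lra.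
      by rewrite tpermR eqxx !F1 mulr1 mul1r.
    rewrite (negPf kj) => nz; have := contraNN (fun H => @stay' k l H nz).
    rewrite negb_or ki kj negb_or => /(_ isT)/andP[li lj].
    have -> : tperm i j l = l by rewrite tpermD // eq_sym.
    by rewrite (negPf lj) mul1r mulr1.
  have /= Frij := Frig autd.
  pose xi := enum_rank_in Hi i; pose xj := enum_rank_in Hi j.
  have xiE : enum_val xi = i by rewrite enum_rankK_in.
  have xjE : enum_val xj = j by rewrite enum_rankK_in.
  have tst : tperm xi xj \in kernel_stab (@class_kernel a).
    apply/kernel_stabP=> u v; rewrite /class_kernel.
    by rewrite !(inj_tperm _ _ _ enum_val_inj) xiE xjE Frij.
  have t1 : subg (kernel_stab_Group (@class_kernel a)) (tperm xi xj) = 1%g.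
    by apply/set1gP; rewrite -triv finset.in_setT.
  have : sgval (subg (kernel_stab_Group (@class_kernel a)) (tperm xi xj)) =
    tperm xi xj.
    by rewrite subgK.
  rewrite t1 => /permP/(_ xi); rewrite tpermL perm1 => /(congr1 enum_val).
  by rewrite xiE xjE => ij'; rewrite ij' eqxx in ij.
- by exists i, j; split=> //; exists x.
- by exists j, i; split=> //; [rewrite eq_sym|rewrite finset.setUC|exists y].
(* With both entries -oo, [i] would be linked to nothing but itself. *)
have cl : closed linked [pred k | k == i].
  have half k l : linked k l -> k == i -> l == i.
    move=> kl /eqP ki; rewrite ki in kl.
    have : (l == i) || (l == j).
      by case/orP: kl => nz; [apply: (@stay i l)|apply: (@stay' l i)];
        rewrite ?eqxx.
    case/orP => // /eqP lj; move: kl; rewrite lj /linked /= Fij Fji.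
    by rewrite eqxx.
  apply: intro_closed => // k l; exact: half.
by have := closed_connect cl conn_ij; rewrite !inE eqxx eq_sym (negPf ij).
Qed.

(* Two components with a single finite off-diagonal entry each, with values x
   and y, are exchanged by an automorphism: the gauges y - x and x - y at the
   heads of the two edges make up for the difference. *)
Let size2_trivial_class_unique a b : class_size a = 2%N -> class_size b = 2%N ->
  [set: class_group a]%g = 1%g -> [set: class_group b]%g = 1%g -> a = b.
Proof.
move=> ma mb ta tb; apply: contraTeq isT => nab.
have [i [j [ij Cij [x Fij] Fji]]] := size2_trivial_oriented ma ta.
have [k [l [kl Ckl [y Fkl] Flk]]] := size2_trivial_oriented mb tb.
have inC u c : u \in comp (pt c) -> akin (pt c) u by rewrite inE => /akin_conn.
have Hi : akin (pt a) i by apply: inC; rewrite Cij set21.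
have Hj : akin (pt a) j by apply: inC; rewrite Cij set22.
have Hk : akin (pt b) k by apply: inC; rewrite Ckl set21.
have Hl : akin (pt b) l by apply: inC; rewrite Ckl set22.
have ne u v : akin (pt a) u -> akin (pt b) v -> u != v.
  move=> au bv; apply: contraNneq nab => uv; apply/eqP/pt_akin.
  by apply: akin_trans au _; rewrite uv akin_sym.
have ik := ne _ _ Hi Hk; have il := ne _ _ Hi Hl.
have jk := ne _ _ Hj Hk; have jl := ne _ _ Hj Hl.
pose f u := if u == i then k else if u == k then i else
            if u == j then l else if u == l then j else u.
have fi : f i = k by rewrite /f eqxx.
have fk : f k = i by rewrite /f eq_sym (negPf ik) eqxx.
have fj : f j = l by rewrite /f eq_sym (negPf ij) (negPf jk) eqxx.
have fl : f l = j.
  by rewrite /f eq_sym (negPf il) eq_sym (negPf kl) eq_sym (negPf jl) eqxx.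
have fD u : u != i -> u != j -> u != k -> u != l -> f u = u.
  by rewrite /f => /negPf -> /negPf -> /negPf -> /negPf ->.
have ff : involutive f.
  move=> u; have [->|ui] := eqVneq u i; first by rewrite fi.
  have [->|uj] := eqVneq u j; first by rewrite fj.
  have [->|uk] := eqVneq u k; first by rewrite fk.
  by have [->|ul] := eqVneq u l; [rewrite fl|rewrite !fD].
pose s := perm (inv_inj ff).
pose d : {ffun 'I_r -> Algebra.to_multiplicative R} :=
  [ffun u => if u == j then y - x else if u == l then x - y else 0].
have di : d i = 0 by rewrite ffunE (negPf ij) (negPf il).
have dk : d k = 0 by rewrite ffunE eq_sym (negPf jk) (negPf kl).
have dj : d j = y - x by rewrite ffunE eqxx.
have dl : d l = x - y by rewrite ffunE eq_sym (negPf jl) eqxx.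
have dD u : u != j -> u != l -> d u = 0.
  by rewrite ffunE => /negPf -> /negPf ->.
have inCE c u v : u \in comp (pt c) -> conn u v -> v \in comp (pt c).
  by rewrite !inE; apply: conn_trans.
suff /aut_Gam sG : automorphisms F ((d, s) : W).
  have : akin i k by have := akin_Gam i sG; rewrite permE fi.
  move=> ik'; case/eqP: nab; apply: pt_akin.
  by apply: akin_trans Hi _; apply: akin_trans ik' _; apply: akin_sym.
apply: involution_aut => [u|u v]; first by rewrite !permE.
rewrite !permE.
have [uC|uC] := boolP (u \in comp (pt a)).
  move=> nz; have := inCE _ _ _ uC (F_conn nz); move: uC nz; rewrite Cij !inE.
  case/orP=> /eqP-> nz /orP[]/eqP ev; move: nz;
    rewrite ev ?fi ?fj ?di ?dj ?F1 ?Fij ?Fji ?Fkl ?mulr1 ?mul1r //= => _.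
  by congr Some => /=; lra.
have [uC'|uC'] := boolP (u \in comp (pt b)).
  move=> nz; have := inCE _ _ _ uC' (F_conn nz); move: uC' nz; rewrite Ckl !inE.
  case/orP=> /eqP-> nz /orP[]/eqP ev; move: nz;
    rewrite ev ?fk ?fl ?dk ?dl ?F1 ?Fkl ?Flk ?Fij ?mulr1 ?mul1r //= => _.
  by congr Some => /=; lra.
move=> nz; have := F_conn nz; rewrite conn_sym => vu.
have vC : v \notin comp (pt a) by apply: contra uC => vC; apply: inCE vC vu.
have vC' : v \notin comp (pt b) by apply: contra uC' => vC'; apply: inCE vC' vu.
move: uC uC' vC vC'; rewrite Cij Ckl !inE !negb_or.
move=> /andP[? ?] /andP[? ?] /andP[? ?] /andP[? ?].
by rewrite !fD // !dD // mul1r mulr1.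
Qed.

(** Of three classes of size at most 2, two have the same size. *)
Theorem components_admissible n : (0 < r)%N -> (r <= n)%N ->
  admissible n class_count class_group.
Proof.
move=> r0 rn; split; [exact: num_classes_gt0|exact: class_count_gt0|].
exists class_size; split; first exact: class_size_gt0.
split; [by rewrite sum_class_size|exact: class_group_two_closed
  |exact: size1_class_unique|].
move=> a b c ab ac bc ta tb tc.
case: (ltnP 2 (class_size a)) => [|a2]; first by constructor 1.
case: (ltnP 2 (class_size b)) => [|b2]; first by constructor 2.
case: (ltnP 2 (class_size c)) => [|c2]; first by constructor 3.
have sz d : (class_size d <= 2)%N -> class_size d = 1%N \/ class_size d = 2%N.
  by have := class_size_gt0 d; case: (class_size d) => [|[|[|]]] //;
    [left|right].
exfalso; case: (sz a a2) (sz b b2) (sz c c2) => [ea|ea] [eb|eb] [ec|ec];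
by do [move: ab; rewrite (size1_class_unique ea eb) eqxx|move: ac;
  rewrite (size1_class_unique ea ec) eqxx|
  move: bc; rewrite (size1_class_unique eb ec) eqxx|move: ab;
    rewrite (size2_trivial_class_unique ea eb ta tb) eqxx|
  move: ac; rewrite (size2_trivial_class_unique ea ec ta tc) eqxx|move: bc;
    rewrite (size2_trivial_class_unique eb ec tb tc) eqxx].
Qed.

End Components.

(** * A kernel whose automorphisms form a given two-closed group *)

Section PairOrbits.
Variables (k : nat) (H : {group 'S_k}).

Lemma pair_orbit_eqP (p q : 'I_k * 'I_k) :
  pair_orbit H p = pair_orbit H q <->
  exists2 s : 'S_k, s \in H & pair_act s p = q.
Proof.
have actM (s t : 'S_k) u : pair_act t (pair_act s u) = pair_act (s * t)%g u.
  by rewrite /pair_act !permM.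
have act1 u : pair_act (1%g : 'S_k) u = u by rewrite /pair_act !perm1; case: u.
split=> [pq|[s sH <-]].
  have : q \in pair_orbit H p by rewrite pq; apply/imsetP; exists 1%g;
    rewrite ?group1.
  by case/imsetP=> s sH ->; exists s.
apply/setP=> u; apply/imsetP/imsetP => -[t tH ->].
  by exists (s^-1 * t)%g; [rewrite groupM ?groupV|rewrite actM mulKVg].
by exists (s * t)%g; rewrite ?groupM ?actM.
Qed.

(** A permutation that maps every pair into its own orbit maps each orbit into
    itself, hence onto itself, orbits being finite. *)
Lemma two_closedP (s : 'S_k) : two_closed H ->
  (forall i j, pair_orbit H (s i, s j) = pair_orbit H (i, j)) -> s \in H.
Proof.
move=> clH sP; apply: clH => p; apply/eqP.
have s_inj : injective (pair_act s).
  by move=> [a b] [c d] [/perm_inj -> /perm_inj ->].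
rewrite eqEcard (card_imset _ s_inj) leqnn andbT;
  apply/fintype.subsetP=> _ /imsetP[_ /imsetP[t tH ->] ->].
have <- : pair_orbit H (pair_act s (pair_act t p)) = pair_orbit H p.
  by rewrite sP; apply/esym/pair_orbit_eqP; exists t.
by apply/imsetP; exists 1%g; rewrite ?group1 // /pair_act !perm1.
Qed.

End PairOrbits.

Section OrbitKernel.
Local Open Scope ring_scope.
Variables (R : realType) (k : nat) (H : {group 'S_k}) (T : R).
Hypothesis T_gt0 : 0 < T.

Definition pair_color (i j : 'I_k) : nat := enum_rank (pair_orbit H (i, j)).
(** The diagonal pair orbits are the point orbits, so two points have the same
    level exactly when they lie in the same orbit of [H]; the order of the
    levels is arbitrary. *)
Definition level (i : 'I_k) : nat := pair_color i i.
(** The weights lie between T and 3/2 T. As a sum of two of them exceeds any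
    third, the kernel below is idempotent and reduced. *)
Definition pair_weight (i j : 'I_k) : R :=
  T * (1 + (pair_color i j)%:R / #|{: {set 'I_k * 'I_k}}|%:R / 2).

(** The entries -oo are what lets an automorphism recognise the levels. With
    all entries finite the trivial group on two points would not be obtained,
    since exchanging the two points would then be an automorphism. *)
Definition orbit_kernel (i j : 'I_k) : trop R :=
  if i == j then 1
  else if (level i <= level j)%N then expT (- pair_weight i j) else 0.

(** The value K i j + K j l - K i l along a chain, which gauges and
    isomorphisms do not change; with i = l it is the weight of a cycle of
    length 2. *)
Definition defect (K : 'I_k -> 'I_k -> trop R) (v : R) : Prop :=
  exists i j l, [/\ i != j, j != l, K i j != 0, K j l != 0 &
    expT v * K i l = K i j * K j l].

Notation B := orbit_kernel.

Let color_eq i j i' j' : pair_color i j = pair_color i' j' ->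
  pair_orbit H (i, j) = pair_orbit H (i', j').
Proof. by move=> /val_inj/enum_rank_inj. Qed.

Let color_act (s : 'S_k) i j : s \in H -> pair_color (s i) (s j) = pair_color
  i j.
Proof.
move=> sH; rewrite /pair_color; congr (nat_of_ord (enum_rank _)).
by apply/esym/pair_orbit_eqP; exists s.
Qed.

Let weight_bounds i j : T <= pair_weight i j < 3 / 2 * T.
Proof.
rewrite /pair_weight; set c := (pair_color i j)%:R; set N := #|_|%:R.
have N0 : 0 < N :> R.
  by rewrite ltr0n; apply: leq_ltn_trans (ltn_ord (enum_rank (pair_orbit H (i,
    j)))).
have c0 : 0 <= c / N :> R by rewrite divr_ge0 // ?ltW // ler0n.
have c1 : c / N < 1 :> R by rewrite ltr_pdivrMr // mul1r ltr_nat ltn_ord.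
move: (c / N) c0 c1 => e e0 e1.
have Te0 : 0 <= T * e by rewrite mulr_ge0 // ltW.
have Te1 : T * e < T * 1 by rewrite ltr_pM2l.
by apply/andP; split; lra.
Qed.

Let weight_inj i j i' j' : pair_weight i j = pair_weight i' j' ->
  pair_orbit H (i, j) = pair_orbit H (i', j').
Proof.
move=> /(mulfI (lt0r_neq0 T_gt0))/addrI/mulIf;
  rewrite invr_neq0 ?pnatr_eq0 // => /(_ isT).
have N0 : #|{: {set 'I_k * 'I_k}}|%:R != 0 :> R.
  by rewrite pnatr_eq0 -lt0n; apply: leq_ltn_trans (ltn_ord (enum_rank
    (pair_orbit H (i, j)))).
by move/mulIf; rewrite invr_neq0 // => /(_ isT)/eqP;
  rewrite eqr_nat => /eqP/color_eq.
Qed.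

Lemma orbit_kernel_diag i : B i i = 1.
Proof. by rewrite /orbit_kernel eqxx. Qed.

Let Blt i j : i != j -> (level i <= level j)%N ->
  B i j = expT (- pair_weight i j).
Proof. by rewrite /B => /negPf -> ->. Qed.
Let B_neq0 i j : (B i j != 0) = (level i <= level j)%N.
Proof. by rewrite /B; have [->|ij] := eqVneq i j;
  [rewrite leqnn|case: leqP]. Qed.

Lemma orbit_kernel_trans i j l : le_trop (B i j * B j l) (B i l).
Proof.
have T0 := T_gt0.
have [->|ij] := eqVneq i j; first by rewrite orbit_kernel_diag mul1r
  le_trop_refl.
have [->|jl] := eqVneq j l; first by rewrite orbit_kernel_diag mulr1
  le_trop_refl.
have [lij|lij] := leqP (level i) (level j); last first.
  by rewrite /B (negPf ij) leqNgt lij mul0r.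
have [ljl|ljl] := leqP (level j) (level l); last first.
  by rewrite /B (negPf jl) (leqNgt (level j)) ljl mulr0.
rewrite (Blt ij lij) (Blt jl ljl).
have /andP[w1 _] := weight_bounds i j; have /andP[w2 _] := weight_bounds j l.
have [il|il] := eqVneq i l; first rewrite -il in w2 *.
  have w12 : - pair_weight i j - pair_weight j i <= 0 by lra.
  by rewrite orbit_kernel_diag.
rewrite (Blt il (leq_trans lij ljl)) /=.
by have /andP[_ w3] := weight_bounds i l; lra.
Qed.

Lemma orbit_kernel_antisym i j : le_trop 1 (B i j * B j i) -> i = j.
Proof.
have T0 := T_gt0.
apply: contraTeq => ij.
have [lij|lij] := leqP (level i) (level j); last first.
  by rewrite /B (negPf ij) leqNgt lij mul0r.
have [lji|lji] := leqP (level j) (level i); last first.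
  by rewrite /B [j == i]eq_sym (negPf ij) (leqNgt (level j)) lji mulr0.
rewrite (Blt ij lij) (Blt _ lji) 1?eq_sym //= -ltNge.
by have /andP[w1 _] := weight_bounds i j;
  have /andP[w2 _] := weight_bounds j i; lra.
Qed.

Lemma orbit_kernel_total i j : (B i j != 0) || (B j i != 0).
Proof. by rewrite !B_neq0 leq_total. Qed.

Lemma orbit_kernel_act (s : 'S_k) i j : s \in H -> B (s i) (s j) = B i j.
Proof.
by move=> sH; rewrite /B (inj_eq perm_inj) /level /pair_weight !color_act.
Qed.

Lemma defect_bounds v : defect B v -> - 3 * T < v < - (T / 2).
Proof.
have T0 := T_gt0.
case=> i [j [l [ij jl]]]; rewrite !B_neq0 => lij ljl.
rewrite (Blt ij lij) (Blt jl ljl).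
have /andP[w1 w1'] := weight_bounds i j; have /andP[w2 w2'] :=
  weight_bounds j l.
have [il|il] := eqVneq i l.
  by rewrite -il in w2 w2' *; rewrite orbit_kernel_diag => -[e]; apply/andP;
    split; lra.
rewrite (Blt il (leq_trans lij ljl)) => -[e].
by have /andP[w3 w3'] := weight_bounds i l; apply/andP; split; lra.
Qed.

(* Finite entries compose, so a chain i, j, l of weakly increasing levels has
   a finite value. *)
Let defect_chain i j l : i != j -> j != l ->
  (level i <= level j)%N -> (level j <= level l)%N -> exists v, defect B v.
Proof.
move=> ij jl lij ljl.
have := B_neq0 i l; rewrite (leq_trans lij ljl); case Bil: (B i l) => [c|] // _.
exists (- pair_weight i j - pair_weight j l - c); exists i, j, l.
rewrite !B_neq0; split=> //; rewrite (Blt ij lij) (Blt jl ljl) Bil.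
by congr Some => /=; lra.
Qed.

(** A nontrivial [s] in [H] gives a chain i, s i, i inside one level, and
    three points can always be sorted into a chain by level. *)
Lemma no_defect : (forall v, ~ defect B v) -> H :=: 1%g /\ (k <= 2)%N.
Proof.
move=> nd.
have nd_chain i j l : i != j -> j != l -> (level i <= level j)%N ->
    (level j <= level l)%N -> False.
  by move=> ij jl lij ljl; have [v /nd] := defect_chain ij jl lij ljl.
split.
  apply/trivgP/fintype.subsetP=> s sH; rewrite inE; apply/eqP/permP=> i;
    rewrite perm1.
  apply: contrapT => /eqP si.
  have lsi : level (s i) = level i by apply: color_act.
  by apply: (nd_chain i (s i) i); rewrite ?lsi // eq_sym.
rewrite leqNgt; apply/negP=> k3.
have [a [b [c [ab ac bc]]]] : exists a b c : 'I_k, [/\ a != b, a != c & b != c].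
  by exists (Ordinal (ltn_trans (isT : 0 < 2)%N k3)),
    (Ordinal (ltn_trans (isT : 1 < 2)%N k3)), (Ordinal k3).
have [ba ca cb] : [/\ b != a, c != a & c != b] by rewrite ![_ == a]eq_sym [c
  == b]eq_sym.
have [lab|/ltnW lab] := leqP (level a) (level b);
have [lac|/ltnW lac] := leqP (level a) (level c);
have [lbc|/ltnW lbc] := leqP (level b) (level c);
by [apply: (nd_chain a b c)|apply: (nd_chain a c b)|apply: (nd_chain b a c)
   |apply: (nd_chain b c a)|apply: (nd_chain c a b)|apply: (nd_chain c b a)].
Qed.

Lemma orbit_kernel_connected : connected_kernel B.
Proof.
move=> f fB i j; have /orP[/fB//|/fB->//] := orbit_kernel_total i j.
Qed.

Section Rigidity.
Variables (g : 'S_k) (d : 'I_k -> R).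
Hypothesis gd : forall i j, expT (d i) * B (g i) (g j) = B i j * expT (d j).

Let level_mono i j : (level (g i) <= level (g j))%N = (level i <= level j)%N.
Proof.
by rewrite -!B_neq0; have := gd i j; case: (B i j) => [a|]; case: (B _ _).
Qed.

(* [g i] and [i] dominate equally many levels, so they are on the same one. *)
Let level_fix i : level (g i) = level i.
Proof.
pose below x := [set j | (level j <= level x)%N].
have card_below x : #|below (g x)| = #|below x|.
  rewrite -[RHS](card_imset _ (@perm_inj _ g)); congr #|pred_of_set _|.
  apply/setP=> j; rewrite inE; apply/idP/imsetP => [le_jx|[y]].
    exists (g^-1 j)%g; rewrite ?permKV // inE -level_mono permKV //.
  by rewrite inE => le_yx ->; rewrite level_mono.
have below_lt x y : (level x < level y)%N -> (#|below x| < #|below y|)%N.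
  move=> xy; apply: proper_card; apply/properP; split.
    by apply/fintype.subsetP=> j; rewrite !inE => /leq_trans; apply;
      apply: ltnW.
  by exists y; rewrite !inE ?leqnn // -ltnNge.
case: (ltngtP (level (g i)) (level i)) => // /below_lt;
  by rewrite card_below ltnn.
Qed.

(** Let Q be the top level, so that all entries into Q are finite. As [g]
    fixes every level, [g x] = [s x] for some [s] in [H], and the sum of the
    entries from [x] to Q is the same at [g x] as at [x]. Summing the
    automorphism condition over Q then shows that [d x] is the mean of [d]
    over Q. *)
Lemma orbit_kernel_gauge i j : d i = d j.
Proof.
case: (@arg_maxnP _ i xpredT level isT) => q _ qmax.
pose Q := [pred x | level x == level q].
pose b x y := odflt 0 (B x y).
have bE x y : y \in Q -> B x y = expT (b x y).
  move=> /eqP yq; have := B_neq0 x y; rewrite yq [(_ <= _)%N]qmax // /b.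
  by case: (B x y).
suff dQ x : #|Q|%:R * d x = \sum_(y in Q) d y.
  have Q0 : #|Q|%:R != 0 :> R by rewrite pnatr_eq0 -lt0n; apply/card_gt0P;
    exists q; rewrite inE.
  by apply: (mulfI Q0); rewrite !dQ.
have /color_eq/pair_orbit_eqP[s sH [_ gx]] :
  level x = level (g x) by rewrite level_fix.
have sumQ (t : 'S_k) (f : 'I_k -> R) : (forall y, level (t y) = level y) ->
    \sum_(y in Q) f (t y) = \sum_(y in Q) f y.
  move=> lt; rewrite [RHS](reindex_inj (@perm_inj _ t)).
  by apply: eq_bigl => y; rewrite !inE lt.
have level_s y : level (s y) = level y by apply: color_act.
have row : \sum_(y in Q) b (g x) (g y) = \sum_(y in Q) b x y.
  rewrite (sumQ g) // -(sumQ s) // -gx.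
  by apply: eq_bigr => y _; rewrite /b orbit_kernel_act.
have : \sum_(y in Q) (d x + b (g x) (g y)) = \sum_(y in Q) (b x y + d y).
  apply: eq_bigr => y yQ; have := gd x y; rewrite (bE _ _ yQ) bE; last first.
    by rewrite inE level_fix.
  by case.
by rewrite !big_split /= sumr_const row mulr_natl addrC => /addrI.
Qed.

Lemma orbit_kernel_exact i j : B (g i) (g j) = B i j.
Proof.
apply: (@expT_mulI _ (d i)); rewrite gd mulrC.
by rewrite (orbit_kernel_gauge i j).
Qed.

(** Weights tell the orbits of pairs with increasing levels apart; for the
    other pairs one transposes. *)
Lemma orbit_kernel_group : two_closed H -> g \in H.
Proof.
move=> clH; apply: (two_closedP clH).
have up i j : (level i <= level j)%N ->
    pair_orbit H (g i, g j) = pair_orbit H (i, j).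
  move=> lij; have [->|ij] := eqVneq i j; first by apply/color_eq/level_fix.
  apply: weight_inj; have := orbit_kernel_exact i j.
  rewrite (Blt ij lij) Blt ?level_mono ?(inj_eq perm_inj) //.
  by move=> /expT_inj/oppr_inj.
move=> i j; have [/up//|/ltnW/up/pair_orbit_eqP[s sH [gj gi]]] :=
  leqP (level i) (level j).
by apply/pair_orbit_eqP; exists s; rewrite // /pair_act /= gi gj.
Qed.

End Rigidity.
End OrbitKernel.

(** * Realising an admissible product *)

Section Realise.
Local Open Scope ring_scope.
Variables (R : realType) (z : nat) (h m : 'I_z -> nat).
Variable G : 'I_z -> finGroupType.
Variable H : forall a, {group 'S_(m a)}.
Hypothesis m_gt0 : forall a, (0 < m a)%N.
Hypothesis H_closed : forall a, two_closed (H a).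
Hypothesis H_isog : forall a, [set: G a]%g \isog H a.
Hypothesis m1 : forall a b, m a = 1%N -> m b = 1%N -> a = b.
Hypothesis m2 : forall a b, [set: G a]%g = 1%g -> [set: G b]%g = 1%g ->
  m a = 2%N -> m b = 2%N -> a = b.

(* By [defect_bounds] the defects of the class [a] lie strictly between -3 T
   and -T/2; the ratio 6 of successive scales makes these intervals disjoint. *)
Let T (a : 'I_z) : R := 6 ^+ a.
Let T_gt0 a : 0 < T a. Proof. by rewrite exprn_gt0. Qed.
Let K a := orbit_kernel (H a) (T a).

Let defect_sep a b v : defect (@K a) v -> defect (@K b) v -> a = b.
Proof.
move=> /(defect_bounds (T_gt0 a)) /andP[va va'] /(defect_bounds (T_gt0 b))
  /andP[vb vb'].
have T6 (c d : 'I_z) : (c < d)%N -> 6 * T c <= T d.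
  by move=> cd; rewrite -exprS ler_weXn2l // ler1n.
apply: val_inj; case: (ltngtP (a : nat) b) => // /T6 le6; exfalso; lra.
Qed.

Notation place := (place h m).
Notation r := #|{: place}|.
Notation W := (wreath (Algebra.to_multiplicative R) r).

Let psi (p : place) : 'I_r := enum_rank p.
Let psi' (i : 'I_r) : place := enum_val i.
Let psiK : cancel psi psi' := @enum_rankK _.
Let psi'K : cancel psi' psi := @enum_valK _.

Let block_kernel (p q : place) : trop R :=
  if block p == block q then K (tagged p).2 (tagged_as p q).2 else 0.

Definition block_sum : 'M[trop R]_r :=
  \matrix_(i, j) block_kernel (psi' i) (psi' j).
Notation F := block_sum.

Let F_in a (i : 'I_(h a)) (x y : 'I_(m a)) :
  F (psi (mkplace i x)) (psi (mkplace i y)) = K x y.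
Proof. by rewrite mxE !psiK /block_kernel /block /= eqxx tagged_asE. Qed.

Let F_out p q : block p != block q -> F (psi p) (psi q) = 0.
Proof. by move=> pq; rewrite mxE !psiK /block_kernel (negPf pq). Qed.

Let F_edge p q : F (psi p) (psi q) != 0 -> block p = block q.
Proof. by move=> nz; apply/eqP; apply: contraNT nz => /F_out ->. Qed.

Lemma block_sum_reduced : reduced F.
Proof.
have F_psi (P : 'I_r -> Prop) : (forall p, P (psi p)) -> forall i, P i.
  by move=> Pp i; rewrite -(psi'K i).
have Fii : forall i, F i i = 1.
  by apply: (F_psi _) => -[a [i x]]; rewrite (F_in i) [LHS]orbit_kernel_diag.
have Ftr : forall i j k, le_trop (F i k * F k j) (F i j).
  apply: (F_psi _) => p; apply: (F_psi _) => q; apply: (F_psi _) => s.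
  have [ps|/F_out->] := eqVneq (block p) (block s); last by rewrite mul0r.
  have [sq|/F_out->] := eqVneq (block s) (block q); last by rewrite mulr0.
  have [a [i [x [y [ep es]]]]] := block_eqP ps.
  have [b [j [u [v [es' eq]]]]] := block_eqP sq.
  move: es'; rewrite es => e; have /= ab := congr1 tag e.
  case: b / ab j u v e eq => j u v /mkplace_inj[<- _] ->.
  by rewrite ep !F_in; apply: orbit_kernel_trans.
split=> //.
  apply/matrixP=> i j; rewrite [LHS]mxE; apply: le_trop_anti.
    by apply: sum_trop_le => k; apply: Ftr.
  by have := @le_trop_sum R _ (fun k => F i k * F k j) i; rewrite Fii mul1r.
apply: (F_psi _) => p; apply: (F_psi _) => q.
have [pq|/F_out->] := eqVneq (block p) (block q); last by rewrite mul0r.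
have [a [i [x [y [-> ->]]]]] := block_eqP pq.
by rewrite !F_in => /(orbit_kernel_antisym (T_gt0 a)) ->.
Qed.

Section Automorphism.
Variables (w : W) (Fw : automorphisms F w).

Let sg p : place := psi' (w.2 (psi p)).
Let d p : R := w.1 (psi p).

Let sg_inj : injective sg.
Proof. by move=> p q /(can_inj psi'K)/perm_inj/(can_inj psiK). Qed.

Let F_sg p q : expT (d p) * F (psi (sg p)) (psi (sg q)) = F (psi p) (psi q) *
  expT (d q).
Proof. by rewrite !psi'K; apply: Fw. Qed.

Let sg_block p q : block p = block q -> block (sg p) = block (sg q).
Proof.
have edge u v : F (psi u) (psi v) != 0 -> block (sg u) = block (sg v).
  move=> nz; apply: F_edge; apply: contraNneq nz => e.
  by have := F_sg u v; rewrite e mulr0; case: (F _ _).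
move=> /block_eqP[a [i [x [y [-> ->]]]]].
have : (K x y != 0) || (K y x != 0) by apply: orbit_kernel_total.
rewrite -!(F_in i).
by case/orP=> [/edge|/edge/esym].
Qed.

Lemma automorphism_block a (i : 'I_(h a)) (x0 : 'I_(m a))
    b (j : 'I_(h b)) (y0 : 'I_(m b)) :
  sg (mkplace i x0) = mkplace j y0 ->
  exists2 g : 'I_(m a) -> 'I_(m b), injective g &
    forall x, sg (mkplace i x) = mkplace j (g x).
Proof.
move=> e0; have ex_g x : exists y, sg (mkplace i x) = mkplace j y.
  have : block (sg (mkplace i x)) = block (sg (mkplace i x0)) by apply:
    sg_block.
  rewrite e0; case: (sg _) => c [k y] /= e; have /= /esym cb := congr1 tag e.
  case: c / cb k y e => k y /eqP; rewrite /block eq_Tagged /= => /eqP ->.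
  by exists y.
have [g gE] := choice ex_g; exists g => // x y gxy.
have /sg_inj/mkplace_inj[] // : sg (mkplace i x) = sg (mkplace i y).
by rewrite !gE gxy.
Qed.

(** An injection of blocks compatible with the kernels carries chains to
    chains of the same value. *)
Lemma automorphism_class_le a (i : 'I_(h a)) (x0 : 'I_(m a))
    b (j : 'I_(h b)) (y0 : 'I_(m b)) :
  sg (mkplace i x0) = mkplace j y0 ->
  (m a <= m b)%N /\ forall v, defect (@K a) v -> defect (@K b) v.
Proof.
move=> /automorphism_block[g g_inj gE].
split; first by have := leq_card g g_inj; rewrite !card_ord.
pose e x := d (mkplace i x).
have gK x y : expT (e x) * K (g x) (g y) = K x y * expT (e y).
  by have := F_sg (mkplace i x) (mkplace i y); rewrite !gE !F_in.
have nz x y : K x y != 0 -> K (g x) (g y) != 0.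
  by move=> n0; apply: contraNneq n0 => e0; have := gK x y; rewrite e0 mulr0;
    case: (K x y).
move=> v [x [y [t [xy yt Kxy Kyt def]]]]; exists (g x), (g y), (g t).
split; rewrite ?(inj_eq g_inj) //; try exact: nz.
apply: (@expT_mulI _ (e x)).
transitivity (K x y * K y t * expT (e t)).
  by rewrite mulrCA gK [LHS]mulrA def.
by rewrite [RHS]mulrA gK -[RHS]mulrA gK [RHS]mulrA.
Qed.

End Automorphism.

Let sg_inv (w : W) a (i : 'I_(h a)) (x : 'I_(m a))
    b (j : 'I_(h b)) (y : 'I_(m b)) :
  psi' (w.2 (psi (mkplace i x))) = mkplace j y ->
  psi' ((w^-1)%g.2 (psi (mkplace j y))) = mkplace i x.
Proof. by move=> <-; rewrite psi'K /= permK psiK. Qed.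

(* The inequalities of [automorphism_class_le] for [w] and its inverse give
   equal sizes and equal sets of defects. Disjointness of the ranges of
   defects settles the case with a defect; without one the group is trivial on
   at most two points, where [m1] and [m2] apply. *)
Let same_class (w : W) a (i : 'I_(h a)) (x : 'I_(m a))
    b (j : 'I_(h b)) (y : 'I_(m b)) :
  automorphisms F w -> psi' (w.2 (psi (mkplace i x))) = mkplace j y -> a = b.
Proof.
move=> Fw e; have [le_ab def_ab] := automorphism_class_le Fw e.
have [le_ba def_ba] := automorphism_class_le (automorphismsV Fw) (sg_inv e).
have mab : m a = m b by apply/anti_leq/andP.
have [[v va]|nd] := pselect (exists v, defect (@K a) v).
  exact: defect_sep va (def_ab _ va).
have nda v : ~ defect (@K a) v by move=> va; apply: nd; exists v.
have ndb v : ~ defect (@K b) v by move=> /def_ba; apply: nda.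
have [Ha a2] := no_defect nda; have [Hb _] := no_defect ndb.
have triv c : H c :=: 1%g -> [set: G c]%g = 1%g.
  by move=> Hc; apply/eqP; rewrite (isog_eq1 (H_isog c)) Hc.
have [m_a|] := leqP (m a) 1.
  have m_a1 : m a = 1%N by apply/anti_leq; rewrite m_a m_gt0.
  by apply: m1; rewrite // -mab.
move=> a2'; have m_a2 : m a = 2%N by apply/anti_leq; rewrite a2 a2'.
by apply: m2; rewrite -?mab //; apply: triv.
Qed.

Let block_perm (w : W) a (i : 'I_(h a)) : automorphisms F w ->
  exists (l : 'I_(h a)) (g : 'S_(m a)),
    forall x, psi' (w.2 (psi (mkplace i x))) = mkplace l (g x).
Proof.
move=> Fw; have x0 := Ordinal (m_gt0 a).
case e: (psi' (w.2 (psi (mkplace i x0)))) => [b [j y0]].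
have ab : a = b by apply: same_class Fw e.
case: b / ab j y0 e => j y0 /(automorphism_block Fw)[g g_inj gE].
by exists j, (perm g_inj) => x; rewrite permE gE.
Qed.

Lemma block_sum_rigid : rigid F.
Proof.
move=> w Fw i j; rewrite -(psi'K i) -(psi'K j).
have [e|ne] := eqVneq (block (psi' i)) (block (psi' j)); last first.
  have := Fw (psi (psi' i)) (psi (psi' j)); rewrite (F_out ne) mul0r.
  by case: (F _ _).
have [a [k [x [y [-> ->]]]]] := block_eqP e.
have [l [g gE]] := block_perm k Fw.
pose d u : R := w.1 (psi (mkplace k u)).
have gd u v : expT (d u) * K (g u) (g v) = K u v * expT (d v).
  have := Fw (psi (mkplace k u)) (psi (mkplace k v)).
  by rewrite -(psi'K (w.2 _)) -(psi'K (w.2 (psi (mkplace k v)))) !gE !F_in.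
rewrite -(psi'K (w.2 _)) -(psi'K (w.2 (psi (mkplace k y)))) !gE !F_in.
exact: (orbit_kernel_exact gd).
Qed.

Lemma automorphisms_block_sum_kernels :
  isomorphic_to (@mul W) (automorphisms F) (product_of_wreaths R h G).
Proof.
have ex_iota a : exists f : {morphism [set: G a] >-> {perm 'I_(m a)}},
    ('injm f)%g /\ (f @* [set: G a])%g = H a.
  by have /isogP[f f_inj fE] := H_isog a; exists f.
pose iota a : G a -> 'S_(m a) := projT1 (cid (ex_iota a)).
have iotaP a := projT2 (cid (ex_iota a)).
have iotaH a g : iota a g \in H a.
  by have [_ <-] := iotaP a; apply: mem_morphim; rewrite finset.in_setT.
apply: (@automorphisms_block_sum R z h m G r K F psi psi' iota) => //.
- by move=> a f fP; apply: (@orbit_kernel_connected _ _ (H a) (T a)).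
- by move=> a g g'; rewrite /iota morphM ?finset.in_setT.
- move=> a; have [/injmP inj _] := iotaP a.
  by move=> g g'; apply: inj; rewrite finset.in_setT.
- by move=> a g x y; apply: orbit_kernel_act.
- move=> a s sK.
  have sH : s \in H a.
    apply: (@orbit_kernel_group R _ (H a) (T a) (T_gt0 a) s (fun=> 0)) =>
      // x y.
    by rewrite [_ (s x) _]sK mulrC.
  by move: sH; have [_ <-] := iotaP a; case/morphimP=> g _ _ ->; exists g.
- exact: block_sum_rigid.
- move=> w Fw p; case e: (psi' (w.2 (psi p))) => [b [j y]] /=.
  by move: p e => [a [i x]] e; symmetry; apply: same_class Fw e.
Qed.

End Realise.

Section Padding.
Local Open Scope ring_scope.

Lemma pad_idempotent (S : pzSemiRingType) (r n : nat) (F : 'M[S]_r) :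
  (r <= n)%N -> F *m F = F ->
  exists (A : 'M[S]_(n, r)) (B : 'M[S]_(r, n)),
    B *m A = F /\ (A *m B) *m (A *m B) = A *m B.
Proof.
move=> rn FF; pose J : 'M[S]_(n, r) := pid_mx r;
  pose J' : 'M[S]_(r, n) := pid_mx r.
have J'J : J' *m J = 1%:M by rewrite mul_pid_mx minnn (minn_idPr rn) pid_mx_1.
have BA : F *m J' *m (J *m F) = F.
  by rewrite mulmxA -(mulmxA F J' J) J'J mulmx1 FF.
exists (J *m F), (F *m J'); split=> //.
by rewrite -[LHS]mulmxA (mulmxA (F *m J') (J *m F)) BA mulmxA -(mulmxA J F F)
  FF mulmxA -(mulmxA J F F) FF.
Qed.

End Padding.

(** The trivial group on two points can be replaced by the trivial group on
    one. By admissibility there are at most two classes with trivial group and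
    at most two points, not both of one point; if both have two points, the
    replacement is made in the first of them. *)
Lemma distinguishing_sizes (n z : nat) (h : 'I_z -> nat)
    (G : 'I_z -> finGroupType) :
  admissible n h G -> exists m : 'I_z -> nat,
  [/\ forall a, 0 < m a, \sum_(a < z) m a * h a <= n,
      forall a, two_closed_on (G a) (m a),
      forall a b, m a = 1 -> m b = 1 -> a = b &
      forall a b, [set: G a]%g = 1%g -> [set: G b]%g = 1%g ->
        m a = 2 -> m b = 2 -> a = b].
Proof.
case=> _ _ [m [m_gt0 [sum_m clG m1 m3]]].
pose triv2 a := ([set: G a]%g == 1%g) && (m a == 2).
pose low a := triv2 a && [exists b : 'I_z, (a < b) && triv2 b].
have sz1_triv a : m a = 1 -> [set: G a]%g = 1%g.
  move=> ma; have [S _ /isog_eq1 GS] := clG a; apply/eqP; rewrite GS.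
  rewrite -subG1; apply/fintype.subsetP=> s _; rewrite inE; apply/eqP/permP=> x.
  move: (s x) (perm1 x) => y ->; apply: val_inj.
  by case: x y => x xm [y ym] /=; rewrite ma in xm ym;
    case: x y xm ym => [|//] [|//].
have no_three a b c : a != b -> a != c -> b != c ->
    [set: G a]%g = 1%g -> [set: G b]%g = 1%g -> [set: G c]%g = 1%g ->
    m a <= 2 -> m b <= 2 -> m c <= 2 -> False.
  move=> ab ac bc ta tb tc ma mb mc.
  by case: (m3 a b c ab ac bc ta tb tc); rewrite ltnNge ?ma ?mb ?mc.
have triv2P a : triv2 a -> [set: G a]%g = 1%g /\ m a = 2 by case/andP=> /eqP ?
  /eqP ?.
have lowP a : low a -> [/\ [set: G a]%g = 1%g, m a = 2 &
    exists b : 'I_z, [/\ a < b, [set: G b]%g = 1%g & m b = 2]].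
  case/andP=> /triv2P[ta ma] /existsP[b /andP[ab /triv2P[tb mb]]].
  by split=> //; exists b.
have ltn_neq (a b : 'I_z) : a < b -> a != b by move=> ab;
  rewrite -val_eqE ltn_eqF.
exists (fun a => if low a then 1 else m a); split.
- by move=> a; case: ifP.
- apply: leq_trans sum_m; apply: leq_sum => a _; rewrite leq_mul2r.
  by apply/orP; right; case: ifP.
- move=> a; case: ifP => // /lowP[ta _ _]; exists 1%G.
    by move=> s _; rewrite inE; apply/eqP/permP=> x; rewrite !ord1.
  exact: trivial_isog.
- move=> a b.
  have mixed c d : low c -> low d = false -> m d = 1 -> False.
    move=> /lowP[tc mc [e [ce te me]]] _ md.
    have cd : c != d by apply/eqP=> cd; rewrite cd md in mc.
    have ed : e != d by apply/eqP=> ed; rewrite ed md in me.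
    by apply: (no_three c e d); rewrite ?mc ?me ?md //;
      [apply: ltn_neq|apply: sz1_triv].
  have both c d : low c -> low d -> c < d -> False.
    move=> /lowP[tc mc _] /lowP[td md [e [de te me]]] cd.
    have ce := ltn_trans cd de.
    by apply: (no_three c d e); rewrite ?mc ?me ?md //; apply: ltn_neq.
  case: ifP => la; case: ifP => lb ma mb; last exact: m1.
  - by apply: val_inj; case: (ltngtP a b) => // [/both|/both]; case.
  - by case: (mixed a b).
  by case: (mixed b a).
move=> a b ta tb; case: ifP => // la; case: ifP => // lb ma mb.
have sep c d : low c = false -> m c = 2 -> m d = 2 -> [set: G c]%g = 1%g ->
    [set: G d]%g = 1%g -> c < d -> False.
  move=> /negP lc mc md tc td cd; apply: lc; rewrite /low /triv2 tc mc !eqxx /=.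
  by apply/existsP; exists d; rewrite cd td md !eqxx.
apply: val_inj; case: (ltngtP a b) => // [ab|ba]; first by case: (sep a b).
by case: (sep b a).
Qed.

Lemma admissible_realised (R : realType) (n z : nat) (h : 'I_z -> nat)
    (G : 'I_z -> finGroupType) :
  admissible n h G -> exists H : set 'M[trop R]_n,
    is_maximal_subgroup mulmx H /\ isomorphic_to mulmx H (product_of_wreaths R
      h G).
Proof.
move=> /distinguishing_sizes[m [m_gt0 sum_m clG m1 m2]].
have ex_H a : exists S : {group 'S_(m a)}, two_closed S /\ [set: G a]%g \isog S.
  by have [S ? ?] := clG a; exists S.
pose S a := projT1 (cid (ex_H a)).
have S_cl a : two_closed (S a) by have [] := projT2 (cid (ex_H a)).
have S_isog a : [set: G a]%g \isog S a by have [] := projT2 (cid (ex_H a)).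
have Fred := block_sum_reduced R h S.
have [FF _ _] := Fred.
have rn : #|{: place h m}| <= n.
  apply: leq_trans sum_m; rewrite card_tagged sumnE big_map big_enum.
  by apply: leq_sum => a _; rewrite card_prod !card_ord mulnC.
have [A [B [BA EE]]] := pad_idempotent rn FF.
exists (local_units mulmx (A *m B)%R); split.
  by apply: local_units_maximal EE; apply: mulmxA.
apply: (transport_local_units EE FF (erefl _) BA).
apply: (local_units_reduced Fred).
exact: (automorphisms_block_sum_kernels R h m_gt0 S_cl S_isog m1 m2).
Qed.

Lemma maximal_subgroup_admissible (R : realType) (n : nat) (H :
  set 'M[trop R]_n) :
  is_maximal_subgroup mulmx H -> H <> [set 0%R]%classic ->
  exists (z : nat) (h : 'I_z -> nat) (G : 'I_z -> finGroupType),
    admissible n h G /\ isomorphic_to mulmx H (product_of_wreaths R h G).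
Proof.
move=> /(maximal_subgroupE (@mulmxA _ _ _ _ _))[E EE ->] nz.
have [r [A [B [rn AB red]]]] := reduce_idempotent EE.
have r_gt0 : 0 < r.
  rewrite lt0n; apply/negP=> /eqP r0; apply: nz.
  have E0 : E = 0%R by subst r; rewrite -AB (flatmx0 B) mulmx0.
  rewrite E0; apply/seteqP; split=> [X [<- _ _]|_ ->] /=;
    first by rewrite mul0mx.
  by split; rewrite ?mul0mx //; exists 0%R; rewrite !mul0mx.
have [C [D [CD red' rig]]] := average_idempotent red.
have [FF' F1' _] := red'; have [FF _ _] := red.
exists (num_classes (D *m C)%R), (@class_count _ _ (D *m C)%R),
  (@class_group _ _ (D *m C)%R).
split; first exact: components_admissible.
apply: (transport_local_units EE FF AB (erefl _)).
apply: (transport_local_units FF FF' CD (erefl _)).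
apply: (local_units_reduced red').
exact: automorphisms_components.
Qed.

(* The hypothesis H <> [set 0] sets aside the maximal subgroup of the zero    *)
(* matrix (all entries -oo): it is trivial, whereas a product with 0 < z      *)
(* factors contains a copy of R.                                              *)
Theorem theorem7p8 (R : realType) (n : nat) (n_gt0 : 0 < n) :
  (forall H : set 'M[trop R]_n,
     is_maximal_subgroup mulmx H -> H <> [set 0%R]%classic ->
     exists (z : nat) (h : 'I_z -> nat) (G : 'I_z -> finGroupType),
       admissible n h G /\ isomorphic_to mulmx H (product_of_wreaths R h G))
  /\
  (forall (z : nat) (h : 'I_z -> nat) (G : 'I_z -> finGroupType),
     admissible n h G ->
     exists H : set 'M[trop R]_n,
       is_maximal_subgroup mulmx H /\
       isomorphic_to mulmx H (product_of_wreaths R h G)).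
Proof.
by split=> [H|z h G]; [apply: maximal_subgroup_admissible|apply:
  admissible_realised].
Qed.
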